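(* Let ${}_{K_0}F_{K_1}$ be a simple two-sided vector space of rank 2, and let $\sigma:=\tau_1\tau_0\in\mathrm{Aut}(F)$ denote the composition of the Galois involutions $\tau_i$ corresponding to the extensions $K_i\subset F$. Let $\Lambda=\mathbb S^{nc}(F)[g^{-1}]$. Then: \begin{itemize} \item ${}_{K_0}F_{K_1}$ is algebraic if and only if $\sigma$ has finite order; and in that case $\Lambda_{00}$ is finite over its center (i.e. finitely generated as a module over its center). \item ${}_{K_0}F_{K_1}$ is non-algebraic if and only if $\sigma$ has infinite order; and in that case $\Lambda_{00}$ is a simple ring. \end{itemize}
   Context: All fields have characteristic $\ne 2$. $F$ is a field and $K_0,K_1\subset F$ are subfields of index 2 such that the $K_0$-$K_1$-bimodule $F$ is simple. Integer subscripts on fields are read modulo 2; $\mathrm{Gal}(F/K_i)=\{1,\tau_i\}$. The two-sided vector space ${}_{K_0}F_{K_1}$ is algebraic if there is a common subfield $k\subset K_0,K_1$, of finite index in both, which acts centrally on $F$; otherwise it is non-algebraic. A $\mathbb Z$-indexed algebra $C$ consists of abelian groups $C_{ij}$ ($i,j\in\mathbb Z$) with associative biadditive multiplications $C_{ij}\times C_{jl}\to C_{il}$ and local units $e_i\in C_{ii}$; it is identified with the ring $\bigoplus_{i,j}C_{ij}$, where the product of $C_{ij}$ and $C_{rl}$ is $0$ for $j\neq r$. Tensor algebra $T=T(F)$: $T_{ij}=0$ for $i>j$, $T_{ii}=K_i$, and for $i<j$, $T_{ij}=F\otimes_{K_{i+1}}F\otimes_{K_{i+2}}\cdots\otimes_{K_{j-1}}F$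 ($j-i$ factors), with multiplication given by the tensor product. $A=\mathbb S^{nc}(F)=T/R$, where $R$ is the two-sided ideal generated by $h_i=1\otimes_{K_{i+1}}1+w_{i+1}^{-1}\otimes_{K_{i+1}}w_{i+1}\in T_{i,i+2}$ $(i\in\mathbb Z)$, with $w_{i+1}\in F\setminus K_{i+1}$, $w_{i+1}^2\in K_{i+1}$ (equivalently $0\ne w_{i+1}$, $\tau_{i+1}(w_{i+1})=-w_{i+1}$). The $w_{i+1}$ are chosen with $w_{i+1}\notin K_i$, so that $h_i$ and $g_i:=w_{i+1}h_i=h_iw_{i+1}$ form a $K_i$-basis of $Fh_i=h_iF\subset T_{i,i+2}$. The images $g_i\in A_{i,i+2}$ form a normal family of degree 2: $g_iA_{i+2,j+2}=A_{ij}g_j$ for all $i,j$. It is known that $A$ is a noetherian domain. $\Lambda=A[g^{-1}]$ is the $\mathbb Z$-indexed algebra obtained by formally inverting all the $g_i$ (Ore localisation at the products $g_ig_{i+2}\cdots g_{i+2n-2}$). Elements of $\Lambda_{ij}$ have the form $ag^{-r}$ with $a\in A_{i,j+2r}$ and $g^{-r}=(g_jg_{j+2}\cdots g_{j+2r-2})^{-1}$. $\Lambda_{00}$ is a ring. *)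

(* Defs.v *)
From HB Require Import structures.
From mathcomp Require Import all_boot all_algebra generic_quotient ring_quotient.
From mathcomp.classical Require Import boolp.
From mathcomp.multinomials Require Import freeg.

Set Implicit Arguments.
Unset Strict Implicit.
Unset Printing Implicit Defensive.

Import GRing.Theory.
Local Open Scope ring_scope.
Local Open Scope quotient_scope.

Record zalg := ZAlg {
  zhom :> int -> int -> zmodType;
  zone : forall i, zhom i i;
  zmul : forall i j l, zhom i j -> zhom j l -> zhom i l;
  zmulA : forall i j l m (x : zhom i j) (y : zhom j l) (z : zhom l m),
    zmul x (zmul y z) = zmul (zmul x y) z;
  zmul1l : forall i j (x : zhom i j), zmul (zone i) x = x;
  zmul1r : forall i j (x : zhom i j), zmul x (zone j) = x;
  zmulDl : forall i j l (x y : zhom i j) (z : zhom j l),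
    zmul (x + y) z = zmul x z + zmul y z;
  zmulDr : forall i j l (x : zhom i j) (y z : zhom j l),
    zmul x (y + z) = zmul x y + zmul x z
}.
Arguments zone {_} i.
Arguments zmul {_ i j l} x y.

Section ZalgTheory.
Variable C : zalg.

Lemma zmul0l i j l (x : C j l) : zmul (0 : C i j) x = 0.
Proof. by apply: (addrI (zmul 0 x)); rewrite -zmulDl !addr0. Qed.

Lemma zmul0r i j l (x : C i j) : zmul x (0 : C j l) = 0.
Proof. by apply: (addrI (zmul x 0)); rewrite -zmulDr !addr0. Qed.

Lemma zmulNl i j l (x : C i j) (y : C j l) : zmul (- x) y = - zmul x y.
Proof. by apply: (addrI (zmul x y)); rewrite -zmulDl !subrr zmul0l. Qed.

Lemma zmulNr i j l (x : C i j) (y : C j l) : zmul x (- y) = - zmul x y.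
Proof. by apply: (addrI (zmul x y)); rewrite -zmulDr !subrr zmul0r. Qed.

Lemma zmulBl i j l (x y : C i j) (z : C j l) :
  zmul (x - y) z = zmul x z - zmul y z.
Proof. by rewrite zmulDl zmulNl. Qed.

Lemma zmulBr i j l (x : C i j) (y z : C j l) :
  zmul x (y - z) = zmul x y - zmul x z.
Proof. by rewrite zmulDr zmulNr. Qed.

End ZalgTheory.

Definition zdiag (C : zalg) (i : int) : Type := C i i.
HB.instance Definition _ C i := GRing.Zmodule.on (zdiag C i).
HB.instance Definition _ C i := GRing.Zmodule_isPzRing.Build (zdiag C i)
  (@zmulA C i i i i) (@zmul1l C i i) (@zmul1r C i i)
  (@zmulDl C i i i) (@zmulDr C i i i).

Record zideal (C : zalg) := ZIdeal {
  zmem :> forall i j, C i j -> Prop;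
  zmem0 : forall i j, zmem (0 : C i j);
  zmemB : forall i j (x y : C i j), zmem x -> zmem y -> zmem (x - y);
  zmemMl : forall i j l (a : C i j) (x : C j l), zmem x -> zmem (zmul a x);
  zmemMr : forall i j l (x : C i j) (a : C j l), zmem x -> zmem (zmul x a)
}.

Section ZQuotient.
Variables (C : zalg) (J : zideal C).

Definition zpred i j : pred (C i j) := fun x => `[< J i j x >].

Lemma zpred_zmod_closed i j : zmod_closed (@zpred i j).
Proof.
split=> [|x y]; first exact/asboolP/zmem0.
by move=> /asboolP xJ /asboolP yJ; apply/asboolP/zmemB.
Qed.
HB.instance Definition _ i j :=
  GRing.isZmodClosed.Build (C i j) (@zpred i j) (@zpred_zmod_closed i j).

Definition zquo i j : zmodType := Quotient.quot (GRing.ZmodClosed.clone (C i j) (@zpred i j) _).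

Definition zpi_ i j (x : C i j) : zquo i j := \pi x.
Definition zquo_mul i j l (x : zquo i j) (y : zquo j l) : zquo i l :=
  zpi_ (zmul (repr x) (repr y)).

Lemma zpi_surj i j (x : zquo i j) : exists y, x = zpi_ y.
Proof. by exists (repr x); rewrite /zpi_ reprK. Qed.

Lemma zpi_eqP i j (x y : C i j) : zpi_ x = zpi_ y <-> J i j (x - y).
Proof.
split=> [/eqP|xyJ]; first by rewrite /zpi_ -Quotient.idealrBE => /asboolP.
by apply/eqP; rewrite /zpi_ -Quotient.idealrBE; apply/asboolP.
Qed.

Lemma zpi_D i j (x y : C i j) : zpi_ (x + y) = zpi_ x + zpi_ y.
Proof. exact: raddfD. Qed.

Lemma zpi_M i j l (x : C i j) (y : C j l) :
  zquo_mul (zpi_ x) (zpi_ y) = zpi_ (zmul x y).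
Proof.
set x' := repr (zpi_ x); set y' := repr (zpi_ y).
have hx : J i j (x' - x) by apply/zpi_eqP; rewrite /zpi_ reprK.
have hy : J j l (y' - y) by apply/zpi_eqP; rewrite /zpi_ reprK.
apply/zpi_eqP; rewrite -/x' -/y'.
have -> : zmul x' y' - zmul x y =
    zmul (x' - x) y' - zmul x (- (y' - y)).
  by rewrite zmulNr opprK zmulBl zmulBr addrA subrK.
apply: zmemB; first exact: zmemMr.
apply: zmemMl; rewrite -[- _]add0r; apply: zmemB => //; exact: zmem0.
Qed.

Lemma zquo_mulA i j l m (x : zquo i j) (y : zquo j l) (z : zquo l m) :
  zquo_mul x (zquo_mul y z) = zquo_mul (zquo_mul x y) z.
Proof.
have [a ->] := zpi_surj x; have [b ->] := zpi_surj y.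
by have [c ->] := zpi_surj z; rewrite !zpi_M zmulA.
Qed.

Lemma zquo_mul1l i j (x : zquo i j) : zquo_mul (zpi_ (zone i)) x = x.
Proof. by have [a ->] := zpi_surj x; rewrite zpi_M zmul1l. Qed.

Lemma zquo_mul1r i j (x : zquo i j) : zquo_mul x (zpi_ (zone j)) = x.
Proof. by have [a ->] := zpi_surj x; rewrite zpi_M zmul1r. Qed.

Lemma zquo_mulDl i j l (x y : zquo i j) (z : zquo j l) :
  zquo_mul (x + y) z = zquo_mul x z + zquo_mul y z.
Proof.
have [a ->] := zpi_surj x; have [b ->] := zpi_surj y.
by have [c ->] := zpi_surj z; rewrite -zpi_D !zpi_M zmulDl zpi_D.
Qed.

Lemma zquo_mulDr i j l (x : zquo i j) (y z : zquo j l) :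
  zquo_mul x (y + z) = zquo_mul x y + zquo_mul x z.
Proof.
have [a ->] := zpi_surj x; have [b ->] := zpi_surj y.
by have [c ->] := zpi_surj z; rewrite -zpi_D !zpi_M zmulDr zpi_D.
Qed.

Definition zquotient : zalg :=
  ZAlg zquo_mulA zquo_mul1l zquo_mul1r zquo_mulDl zquo_mulDr.

Definition zpi i j (x : C i j) : zquotient i j := zpi_ x.

End ZQuotient.

Section ZIdealGen.
Variables (C : zalg) (S : forall i j, C i j -> Prop).

Definition zideal_gen_mem i j (x : C i j) : Prop :=
  forall J : zideal C, (forall r s (y : C r s), S y -> J r s y) -> J i j x.

Lemma zideal_gen0 i j : zideal_gen_mem (0 : C i j).
Proof. by move=> J _; apply: zmem0. Qed.

Lemma zideal_genB i j (x y : C i j) :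
  zideal_gen_mem x -> zideal_gen_mem y -> zideal_gen_mem (x - y).
Proof. by move=> hx hy J SJ; apply: zmemB; [apply: hx | apply: hy]. Qed.

Lemma zideal_genMl i j l (a : C i j) (x : C j l) :
  zideal_gen_mem x -> zideal_gen_mem (zmul a x).
Proof. by move=> hx J SJ; apply: zmemMl; apply: hx. Qed.

Lemma zideal_genMr i j l (x : C i j) (a : C j l) :
  zideal_gen_mem x -> zideal_gen_mem (zmul x a).
Proof. by move=> hx J SJ; apply: zmemMr; apply: hx. Qed.

Definition zideal_gen : zideal C :=
  ZIdeal zideal_gen0 zideal_genB zideal_genMl zideal_genMr.

End ZIdealGen.

Record zcat := ZCat {
  zmap :> int -> int -> choiceType;
  zid : forall i, zmap i i;
  zcomp : forall i j l, zmap i j -> zmap j l -> zmap i l;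
  zcompA : forall i j l m (x : zmap i j) (y : zmap j l) (z : zmap l m),
    zcomp x (zcomp y z) = zcomp (zcomp x y) z;
  zcomp1l : forall i j (x : zmap i j), zcomp (zid i) x = x;
  zcomp1r : forall i j (x : zmap i j), zcomp x (zid j) = x
}.
Arguments zid {_} i.
Arguments zcomp {_ i j l} x y.

Section FreegLift.
Variables (K : choiceType) (V : zmodType).
Implicit Types (f g : K -> V) (D : {freeg K}).

Definition flift f D : V := \sum_(x <- dom D) f x *~ coeff x D.

Lemma flift_sub f D (s : seq K) : uniq s -> {subset dom D <= s} ->
  flift f D = \sum_(x <- s) f x *~ coeff x D.
Proof.
move=> us sub; rewrite (bigID (mem (dom D))) /= [X in _ + X]big1 ?addr0.
  rewrite -big_filter; apply: perm_big; apply: uniq_perm.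
  - exact: uniq_dom.
  - exact: filter_uniq.
  - by move=> x; rewrite mem_filter andb_idr //; apply: sub.
by move=> x xD; rewrite coeff_outdom ?mulr0z.
Qed.

Lemma fliftB f : zmod_morphism (flift f).
Proof.
move=> D E; pose s := undup (dom D ++ dom E).
have us : uniq s by apply: undup_uniq.
rewrite (@flift_sub f D s) //; last by move=> x xD; rewrite mem_undup mem_cat xD.
rewrite (@flift_sub f E s) //; last first.
  by move=> x xE; rewrite mem_undup mem_cat xE orbT.
rewrite (@flift_sub f (D - E) s) //; last first.
  by move=> x /domB xDE; rewrite mem_undup.
by rewrite -sumrB; apply: eq_bigr => x _; rewrite coeffB mulrzBr.
Qed.
HB.instance Definition _ f :=
  GRing.isZmodMorphism.Build {freeg K} V (flift f) (fliftB f).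

Lemma fliftU f x : flift f << x >> = f x.
Proof. by rewrite /flift domU1 big_seq1 coeffU eqxx mulr1. Qed.

Lemma freeg_ind_span (P : {freeg K} -> Prop) :
    P 0 -> (forall D E, P D -> P E -> P (D - E)) -> (forall x, P << x >>) ->
  forall D, P D.
Proof.
move=> P0 PB PU D; have PN E : P E -> P (- E) by rewrite -sub0r; apply: PB.
have PD E E' : P E -> P E' -> P (E + E').
  by move=> hE hE'; rewrite -[E']opprK; apply: PB => //; apply: PN.
have PM n x : P << (Posz n) *g x >>.
  elim: n => [|n IH]; first by rewrite freegU0.
  by rewrite intS -freegUD; apply: PD.
rewrite -[D]freeg_sumE; apply: (big_rec P) => // x E _ hE; apply: PD => //.
case: (coeff x D) => n //; rewrite NegzE -freegUN; exact: PN.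
Qed.

End FreegLift.

Section ZLinearisation.
Variable W : zcat.

Local Notation "'FW'" := (fun i j => ({freeg (W i j)} : zmodType)).

Definition flin_mul i j l (D : {freeg (W i j)}) (E : {freeg (W j l)}) :
    {freeg (W i l)} :=
  flift (fun x => flift (fun y => << zcomp x y >>) E) D.

Lemma flin_mulBl i j l (D D' : {freeg (W i j)}) (E : {freeg (W j l)}) :
  flin_mul (D - D') E = flin_mul D E - flin_mul D' E.
Proof. exact: raddfB. Qed.

Lemma flin_mulBr i j l (D : {freeg (W i j)}) (E E' : {freeg (W j l)}) :
  flin_mul D (E - E') = flin_mul D E - flin_mul D E'.
Proof.
rewrite /flin_mul /flift -sumrB; apply: eq_bigr => x _.
by rewrite -mulrzBl; congr (_ *~ _); apply: (raddfB (flift _)).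
Qed.

Lemma flin_mulUU i j l (x : W i j) (y : W j l) :
  flin_mul << x >> << y >> = << zcomp x y >>.
Proof. by rewrite /flin_mul !fliftU. Qed.

Lemma flin_mul0l i j l (E : {freeg (W j l)}) :
  flin_mul (0 : {freeg (W i j)}) E = 0.
Proof. by rewrite -[0](subrr 0) flin_mulBl subrr. Qed.

Lemma flin_mul0r i j l (D : {freeg (W i j)}) :
  flin_mul D (0 : {freeg (W j l)}) = 0.
Proof. by rewrite -[0](subrr 0) flin_mulBr subrr. Qed.

Lemma flin_mulDl i j l (D D' : {freeg (W i j)}) (E : {freeg (W j l)}) :
  flin_mul (D + D') E = flin_mul D E + flin_mul D' E.
Proof.
by rewrite -{1}[D']opprK flin_mulBl -[- D']sub0r flin_mulBl flin_mul0l sub0r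
           opprK.
Qed.

Lemma flin_mulDr i j l (D : {freeg (W i j)}) (E E' : {freeg (W j l)}) :
  flin_mul D (E + E') = flin_mul D E + flin_mul D E'.
Proof.
by rewrite -{1}[E']opprK flin_mulBr -[- E']sub0r flin_mulBr flin_mul0r sub0r
           opprK.
Qed.

Lemma flin_mulA i j l m (x : {freeg (W i j)}) (y : {freeg (W j l)})
    (z : {freeg (W l m)}) :
  flin_mul x (flin_mul y z) = flin_mul (flin_mul x y) z.
Proof.
elim/freeg_ind_span: x => [|D E hD hE|x]; first by rewrite !flin_mul0l.
  by rewrite !flin_mulBl hD hE.
elim/freeg_ind_span: y => [|D E hD hE|y].
- by rewrite flin_mul0l !flin_mul0r flin_mul0l.
- by rewrite flin_mulBl !flin_mulBr flin_mulBl hD hE.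
elim/freeg_ind_span: z => [|D E hD hE|z]; first by rewrite !flin_mul0r.
  by rewrite !flin_mulBr hD hE.
by rewrite !flin_mulUU zcompA.
Qed.

Lemma flin_mul1l i j (x : {freeg (W i j)}) : flin_mul << zid i >> x = x.
Proof.
elim/freeg_ind_span: x => [|D E hD hE|x]; first by rewrite flin_mul0r.
  by rewrite flin_mulBr hD hE.
by rewrite flin_mulUU zcomp1l.
Qed.

Lemma flin_mul1r i j (x : {freeg (W i j)}) : flin_mul x << zid j >> = x.
Proof.
elim/freeg_ind_span: x => [|D E hD hE|x]; first by rewrite flin_mul0l.
  by rewrite flin_mulBl hD hE.
by rewrite flin_mulUU zcomp1r.
Qed.

Definition zlin : zalg :=
  @ZAlg (fun i j => {freeg (W i j)} : zmodType) (fun i => << zid i >>) flin_mul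
    flin_mulA flin_mul1l flin_mul1r flin_mulDl flin_mulDr.

Definition zbasis i j (x : W i j) : zlin i j := << x >>.

End ZLinearisation.

Section TwoSided.
Variable F : fieldType.

(* [E : k] = n, via a basis of E over k. *)
Definition subfield_index (k E : {pred F}) (n : nat) : Prop :=
  exists b : 'I_n -> F, (forall t, b t \in E) /\
    forall x, x \in E -> exists! c : {ffun 'I_n -> F},
      (forall t, c t \in k) /\ x = \sum_t c t * b t.

(* Simplicity of F as a K0-K1-bimodule; F is nonzero since it is a field. *)
Definition simple_bimodule (K0 K1 : {pred F}) : Prop :=
  forall V : F -> Prop,
    V 0 -> (forall x y, V x -> V y -> V (x - y)) ->
    (forall a x, a \in K0 -> V x -> V (a * x)) ->
    (forall x b, b \in K1 -> V x -> V (x * b)) ->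
    (forall x, V x -> x = 0) \/ (forall x, V x).

(* The centrality clause is automatic here, both actions on F being given by
   the multiplication of the field F. *)
Definition algebraic_bimodule (K0 K1 : {pred F}) : Prop :=
  exists k : divringClosed F,
    [/\ {subset k <= K0}, {subset k <= K1},
        exists n, subfield_index k K0 n,
        exists n, subfield_index k K1 n
      & forall a x, a \in k -> a * x = x * a].

(* Gal(F/K) = {1, tau} with tau <> 1. *)
Definition galois_involution (K : {pred F}) (tau : {rmorphism F -> F}) : Prop :=
  [/\ bijective tau, ~ tau =1 id
    & forall s : {rmorphism F -> F}, bijective s ->
        ({in K, forall x, s x = x} <-> s =1 id \/ s =1 tau)].

Definition finite_order (s : F -> F) : Prop :=
  exists2 n, (0 < n)%N & iter n s =1 id.

End TwoSided.

Section TensorAlgebra.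
Variables (F : fieldType) (K0 K1 : divringClosed F).

Definition Kmod2 (i : int) : divringClosed F := if odd `|i|%N then K1 else K0.

(* Since K_i (x)_{K_i} F = F, all cases of the definition of T_ij are covered by
   K_i (x)_{K_i} F (x)_{K_{i+1}} F (x) ... (x)_{K_{j-1}} F, with j - i factors F.
   A pure tensor x_0 (x) x_1 (x) ... (x) x_{j-i} of this kind, with x_0 in K_i,
   is encoded by the pair (x_0, [:: x_1; ...; x_{j-i}]); there is none if
   j < i. *)
Definition tword_pred (i j : int) (u : F * seq F) : bool :=
  (u.1 \in Kmod2 i) && ((size u.2)%:Z == j - i).

Definition tword (i j : int) : choiceType :=
  {u : F * seq F | tword_pred i j u} : choiceType.

Definition tseq i j (u : tword i j) : seq F := (val u).1 :: (val u).2.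

(* (x_0,...,x_m) (y_0,...,y_n) = (x_0,...,x_{m-1}, x_m y_0, y_1,...,y_n) *)
Fixpoint tglue (c : F) (s : seq F) (v : F * seq F) : F * seq F :=
  if s is a :: s' then (c, (tglue a s' v).1 :: (tglue a s' v).2)
  else (c * v.1, v.2).

Lemma size_tglue c s v : size (tglue c s v).2 = (size s + size v.2)%N.
Proof. by elim: s c => //= a s IH c; rewrite IH. Qed.

Lemma tglue_subproof i j l (u : tword i j) (v : tword j l) :
  tword_pred i l (tglue (val u).1 (val u).2 (val v)).
Proof.
case: u v => [[c s] /= /andP[/= cK /eqP ss]] [v /= /andP[vK /eqP sv]].
apply/andP; split.
  case: s ss => [|a s] //= ss; apply: rpredM => //.
  by move/esym/eqP: ss; rewrite subr_eq0 => /eqP <-.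
by rewrite size_tglue PoszD ss sv addrC addrA subrK.
Qed.

Definition tword_comp i j l (u : tword i j) (v : tword j l) : tword i l :=
  Sub (tglue (val u).1 (val u).2 (val v)) (tglue_subproof u v).

Lemma tword_id_subproof i : tword_pred i i (1, [::]).
Proof. by rewrite /tword_pred /= rpred1 subrr. Qed.

Definition tword_id i : tword i i := Sub (1, [::]) (tword_id_subproof i).

Lemma tglueA c s u v :
  tglue (tglue c s u).1 (tglue c s u).2 v =
  tglue c s (tglue u.1 u.2 v).
Proof.
elim: s c => [|a s IH] c /=; last by rewrite IH.
by case: u => x [|y t] /=; rewrite ?mulrA.
Qed.

Lemma tword_compA i j l m (x : tword i j) (y : tword j l) (z : tword l m) :
  tword_comp x (tword_comp y z) = tword_comp (tword_comp x y) z.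
Proof. by apply: val_inj; rewrite /= tglueA. Qed.

Lemma tword_comp1l i j (x : tword i j) : tword_comp (tword_id i) x = x.
Proof. by apply: val_inj; rewrite /= mul1r; case: (val x). Qed.

Lemma tword_comp1r i j (x : tword i j) : tword_comp x (tword_id j) = x.
Proof.
apply: val_inj => /=; case: (val x) => c s /=.
by elim: s c => [|a s IH] c /=; rewrite ?mulr1 ?IH.
Qed.

Definition tword_cat : zcat := ZCat tword_compA tword_comp1l tword_comp1r.

Local Notation L := (zlin tword_cat).

(* Additivity in each slot, and balancing at the junction of the slots
   x_n and x_{n+1}, which is over K_{i+n}. *)
Inductive tensor_rel (i j : int) : L i j -> Prop :=
| TensorAdd (p q : seq F) (a b : F) (u v w : tword i j) :
    tseq u = p ++ (a + b) :: q -> tseq v = p ++ a :: q ->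
    tseq w = p ++ b :: q ->
    tensor_rel (@zbasis tword_cat i j u - @zbasis tword_cat i j v
                - @zbasis tword_cat i j w)
| TensorBal (p q : seq F) (a k b : F) (u v : tword i j) :
    k \in Kmod2 (i + (size p)%:Z) ->
    tseq u = p ++ a * k :: b :: q -> tseq v = p ++ a :: k * b :: q ->
    tensor_rel (@zbasis tword_cat i j u - @zbasis tword_cat i j v).

Definition tensor_mem i j (x : L i j) : Prop :=
  forall P : L i j -> Prop,
    P 0 -> (forall y z, P y -> P z -> P (y - z)) ->
    (forall y, tensor_rel y -> P y) -> P x.

Lemma tensor_mem0 i j : tensor_mem (0 : L i j).
Proof. by move=> P P0. Qed.

Lemma tensor_memB i j (x y : L i j) :
  tensor_mem x -> tensor_mem y -> tensor_mem (x - y).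
Proof.
by move=> hx hy P P0 PB PS; apply: (PB); [exact: hx | exact: hy].
Qed.

Lemma tensor_mem_rel i j (x : L i j) : tensor_rel x -> tensor_mem x.
Proof. by move=> hx P _ _; apply. Qed.

Lemma tglue_seq c s v :
  (tglue c s v).1 :: (tglue c s v).2 =
  belast c s ++ (last c s * v.1) :: v.2.
Proof. by elim: s c => //= a s IH c; rewrite IH. Qed.

Lemma tglue_seqr p q a c s v : c :: s = p ++ a :: q ->
  (tglue c s v).1 :: (tglue c s v).2 =
  if q is b :: q' then p ++ a :: (tglue b q' v).1 :: (tglue b q' v).2
  else p ++ a * v.1 :: v.2.
Proof.
elim: p c s => [|x p IH] c s /= [-> ->]; first by case: q.
case E: (p ++ a :: q) => [|y t] /=; first by move: E; case: (p).
by rewrite (IH y t (esym E)); case: q {IH E}.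
Qed.

Lemma tseq_comp i j l (u : tword i j) (v : tword j l) :
  tseq (tword_comp u v) =
  belast (val u).1 (val u).2 ++ (last (val u).1 (val u).2 * (val v).1)
    :: (val v).2.
Proof. exact: tglue_seq. Qed.

Lemma tensor_rel_Ml i j l (u : tword i j) (x : L j l) :
  tensor_rel x -> tensor_rel (zmul (@zbasis tword_cat i j u : L i j) x).
Proof.
pose c := (val u).1; pose s := (val u).2.
have comp (w : tword j l) p a q : tseq w = p ++ a :: q ->
    tseq (tword_comp u w) = if p is y :: p' then
      (belast c s ++ last c s * y :: p') ++ a :: q
      else belast c s ++ last c s * a :: q.
  rewrite tseq_comp /tseq => e; case: p e => [|y p] /= [-> ->] //.
  by rewrite -catA.
have us : (size s)%:Z = j - i by have /andP[_ /eqP] := valP u.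
case=> [p q a b u' v w eu ev ew|p q a k b u' v kK eu ev];
  rewrite !zmulBr /= /zbasis !flin_mulUU /=.
  have := comp _ _ _ _ eu; have := comp _ _ _ _ ev; have := comp _ _ _ _ ew.
  case: p {eu ev ew} => [|y p] ew ev eu; last exact: TensorAdd eu ev ew.
  by rewrite mulrDr in eu; exact: TensorAdd eu ev ew.
have := comp _ _ _ _ eu; have := comp _ _ _ _ ev.
case: p kK {eu ev} => [|y p] kK ev eu.
  rewrite mulrA in eu; apply: TensorBal eu ev.
  by rewrite size_belast us addrC subrK; rewrite addr0 in kK.
apply: TensorBal eu ev.
rewrite size_cat size_belast /= PoszD us addrA.
by rewrite [i + _]addrC subrK.
Qed.

Lemma tensor_rel_Mr i j l (x : L i j) (v : tword j l) :
  tensor_rel x -> tensor_rel (zmul x (@zbasis tword_cat j l v : L j l)).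
Proof.
have comp (w : tword i j) p a q : tseq w = p ++ a :: q ->
    tseq (tword_comp w v) = if q is b :: q' then
      p ++ a :: (tglue b q' (val v)).1 :: (tglue b q' (val v)).2
      else p ++ a * (val v).1 :: (val v).2.
  exact: tglue_seqr.
case=> [p q a b u v' w eu ev ew|p q a k b u v' kK eu ev];
  rewrite !zmulBl /= /zbasis !flin_mulUU /=.
  have := comp _ _ _ _ eu; have := comp _ _ _ _ ev; have := comp _ _ _ _ ew.
  case: q {eu ev ew} => [|y q] ew ev eu; last exact: TensorAdd eu ev ew.
  by rewrite mulrDl in eu; exact: TensorAdd eu ev ew.
have := comp _ _ _ _ eu; have := comp _ _ _ _ ev.
case: q {eu ev} => [|y q] /= ev eu; last exact: TensorBal kK eu ev.
by rewrite -mulrA in ev; exact: TensorBal kK eu ev.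
Qed.

Lemma tensor_memMl i j l (a : L i j) (x : L j l) :
  tensor_mem x -> tensor_mem (zmul a x).
Proof.
move=> hx; apply: (hx (fun x => tensor_mem (zmul a x))) => [|y z hy hz|y hy].
- by rewrite zmul0r; exact: tensor_mem0.
- by rewrite zmulBr; exact: (tensor_memB hy hz).
elim/freeg_ind_span: a => [|D E hD hE|u].
- by rewrite (zmul0l (C := L)); exact: tensor_mem0.
- by rewrite (zmulBl (C := L)); exact: (tensor_memB hD hE).
- exact: (tensor_mem_rel (tensor_rel_Ml u hy)).
Qed.

Lemma tensor_memMr i j l (x : L i j) (a : L j l) :
  tensor_mem x -> tensor_mem (zmul x a).
Proof.
move=> hx; apply: (hx (fun x => tensor_mem (zmul x a))) => [|y z hy hz|y hy].
- by rewrite zmul0l; exact: tensor_mem0.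
- by rewrite zmulBl; exact: (tensor_memB hy hz).
elim/freeg_ind_span: a => [|D E hD hE|u].
- by rewrite (zmul0r (C := L)); exact: tensor_mem0.
- by rewrite (zmulBr (C := L)); exact: (tensor_memB hD hE).
- exact: (tensor_mem_rel (tensor_rel_Mr u hy)).
Qed.

(* The subgroup spanned by the relations is already an ideal. *)
Definition tensor_ideal : zideal L :=
  ZIdeal tensor_mem0 tensor_memB tensor_memMl tensor_memMr.

Definition tensor_alg : zalg := zquotient tensor_ideal.

Lemma tens2_subproof i (a b : F) : tword_pred i (i + 2) (1, [:: a; b]).
Proof. by rewrite /tword_pred /= rpred1 [i + 2]addrC addrK. Qed.

(* a (x)_{K_{i+1}} b in T_{i,i+2} *)
Definition tens2 i (a b : F) : tensor_alg i (i + 2) :=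
  zpi tensor_ideal (@zbasis tword_cat i (i + 2)
    (Sub (1, [:: a; b]) (tens2_subproof i a b))).

End TensorAlgebra.

Section Snc.
Variables (F : fieldType) (K0 K1 : divringClosed F) (w : int -> F).

Local Notation K := (Kmod2 K0 K1).
Local Notation T := (tensor_alg K0 K1).

Definition admissible_w : Prop :=
  forall i, [/\ w (i + 1) \notin K (i + 1), w (i + 1) ^+ 2 \in K (i + 1)
              & w (i + 1) \notin K i].

Definition h_elt i : T i (i + 2) :=
  tens2 K0 K1 i 1 1 + tens2 K0 K1 i (w (i + 1))^-1 (w (i + 1)).

Inductive h_rel : forall i j, T i j -> Prop :=
| HRel i : h_rel (h_elt i).

Definition Snc : zalg := zquotient (zideal_gen h_rel).

(* g_i = w_{i+1} h_i, with w_{i+1} multiplying the first tensor factor *)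
Definition g_elt i : Snc i (i + 2) :=
  zpi (zideal_gen h_rel)
    (tens2 K0 K1 i (w (i + 1)) 1 +
     tens2 K0 K1 i (w (i + 1) * (w (i + 1))^-1) (w (i + 1))).

End Snc.

Section Localization.
Variables (A : zalg) (g : forall i, A i (i + 2)).

(* Words in the elements of A and formal symbols g_i^{-1} from i+2 to i. *)
Inductive lword : int -> int -> Type :=
| LNil i : lword i i
| LElt i j l : A i j -> lword j l -> lword i l
| LInv i l : lword i l -> lword (i + 2) l.

HB.instance Definition _ i j := gen_eqMixin (lword i j).
HB.instance Definition _ i j := gen_choiceMixin (lword i j).

Fixpoint lword_comp i j l (x : lword i j) : lword j l -> lword i l :=
  match x in lword i j return lword j l -> lword i l with
  | LNil _ => fun y => y
  | LElt _ _ _ a x' => fun y => LElt a (lword_comp x' y)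
  | LInv _ _ x' => fun y => LInv (lword_comp x' y)
  end.

Lemma lword_compA i j l m (x : lword i j) (y : lword j l) (z : lword l m) :
  lword_comp x (lword_comp y z) = lword_comp (lword_comp x y) z.
Proof. by elim: x y => //= *; congr (_ _); auto. Qed.

Lemma lword_comp1l i j (x : lword i j) : lword_comp (LNil i) x = x.
Proof. by []. Qed.

Lemma lword_comp1r i j (x : lword i j) : lword_comp x (LNil j) = x.
Proof. by elim: x => //= [? ? ? a x ->|? ? x ->]. Qed.

Definition lword_cat : zcat :=
  @ZCat (fun i j => lword i j : choiceType) LNil lword_comp
    lword_compA lword_comp1l lword_comp1r.

Local Notation L := (zlin lword_cat).

Definition lelt i j (a : A i j) : L i j :=
  @zbasis lword_cat i j (LElt a (LNil j)).
Definition linv i : L (i + 2) i :=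
  @zbasis lword_cat (i + 2) i (LInv (LNil i)).

(* a |-> lelt a is a morphism of Z-indexed algebras, and linv i is a two-sided
   inverse of lelt (g i). *)
Inductive loc_rel : forall i j, L i j -> Prop :=
| LocAdd i j (a b : A i j) : loc_rel (lelt (a + b) - lelt a - lelt b)
| LocMul i j l (a : A i j) (b : A j l) :
    loc_rel (lelt (zmul a b) - zmul (lelt a) (lelt b))
| LocOne i : loc_rel (lelt (zone i) - zone i)
| LocInvr i : loc_rel (zmul (lelt (g i)) (linv i) - zone i)
| LocInvl i : loc_rel (zmul (linv i) (lelt (g i)) - zone (i + 2)).

(* The universal Z-indexed algebra under A in which all g_i are invertible,
   which is the Ore localisation when the Ore condition holds. *)
Definition localization : zalg := zquotient (zideal_gen loc_rel).

End Localization.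

Section Rings.
Variable R : pzRingType.

Definition is_central (z : R) : Prop := forall x, z * x = x * z.

Definition finite_over_center : Prop :=
  exists (n : nat) (b : 'I_n -> R), forall x, exists c : 'I_n -> R,
    (forall t, is_central (c t)) /\ x = \sum_t c t * b t.

Definition two_sided_ideal (I : R -> Prop) : Prop :=
  [/\ I 0, forall x y, I x -> I y -> I (x - y),
      forall a x, I x -> I (a * x) & forall x a, I x -> I (x * a)].

Definition simple_ring : Prop :=
  (1 : R) <> 0 /\
  forall I, two_sided_ideal I -> (forall x, I x -> x = 0) \/ (forall x, I x).

End Rings.

(* Main.v *)
(* Let D be the infinite dihedral group generated by the reflections t_0, t_1,
   acting on F through tau_0, tau_1, and let e_i = (1 + t_i)/2.  In the skew
   group ring S = F * D one has e_i F e_{i+1} = F as a bimodule, and up to signs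
   Lambda_ij is e_i S e_j.  In particular Lambda_00 is the ring of
   tau_0-invariants of the skew Laurent ring F[z, z^-1; sigma] for the
   involution a z^n |-> tau_0(a) z^-n, spanned by the elements
   Y_n(a) = a z^n + tau_0(a) z^-n, with
     Y_m(a) Y_n(b) = Y_{m+n}(a sigma^m(b)) + Y_{n-m}(tau_0(a) sigma^-m(b)).
   These elements and their products are derived from the presentation of
   Lambda; linear independence is never needed, only 1 <> 0, which follows from
   an action of Lambda on F by additive maps.
   If sigma^N = 1, then Y_N(1) and the k-multiples of 1 are central and the
   Y_n(b), n <= N, b in a k-basis of F, generate.  If sigma has infinite order,
   a nonzero element of an ideal is reduced to a single Y_n(a) by a quadratic
   polynomial in multiplications by elements of K_0, and 1 is obtained from
   products of two elements Y_n.
   Algebraicity corresponds to finite order by the theorems of Dedekind and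
   Artin on the independence and the fixed fields of automorphisms. *)

Require Import Defs.
From HB Require Import structures.
From mathcomp Require Import all_boot all_algebra.
From mathcomp Require Import generic_quotient ring_quotient.
From mathcomp.classical Require Import boolp.
From mathcomp.multinomials Require Import freeg.
From mathcomp Require Import ring zify.

Set Implicit Arguments.
Unset Strict Implicit.
Unset Printing Implicit Defensive.

Import GRing.Theory.
Local Open Scope ring_scope.

(** * Products in the invariants of a skew Laurent ring *)

Section IterateMorphism.
Variables (F : fieldType) (t0 t1 : {rmorphism F -> F}).

(** The powers of sigma = t1 t0. Negative powers iterate t0 t1, the inverse once both maps are
    involutions, so that each power is a ring morphism before this is assumed. *)
Definition spow (m : int) : F -> F :=
  match m with
  | Posz n => iter n (t1 \o t0)
  | Negz n => iter n.+1 (t0 \o t1)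
  end.

Lemma spow_is_additive m : {morph spow m : x y / x - y}.
Proof.
by case: m => n x y /=; [|rewrite -!rmorphB; congr (t0 (t1 _))];
  elim: n => //= n ->; rewrite !rmorphB.
Qed.

Lemma spow_is_multiplicative m : {morph spow m : x y / x * y}.
Proof.
by case: m => n x y /=; [|rewrite -!rmorphM; congr (t0 (t1 _))];
  elim: n => //= n ->; rewrite !rmorphM.
Qed.

Lemma spow_1 m : spow m 1 = 1.
Proof.
by case: m => n /=; [|rewrite -[RHS](rmorph1 t0) -[in RHS](rmorph1 t1);
  congr (t0 (t1 _))]; elim: n => //= n ->; rewrite !rmorph1.
Qed.

HB.instance Definition _ m := GRing.isZmodMorphism.Build F F (spow m)
  (spow_is_additive m).
HB.instance Definition _ m := GRing.isMonoidMorphism.Build F F (spow m)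
  (spow_1 m, spow_is_multiplicative m).

End IterateMorphism.

Section IterateAutomorphism.
Variables (F : fieldType) (t0 t1 : {rmorphism F -> F}).
Hypotheses (t0K : involutive t0) (t1K : involutive t1).

Local Notation spow := (spow t0 t1).

Lemma spow0 x : spow 0 x = x. Proof. by []. Qed.

Lemma spowN1 x : spow (- 1) x = t0 (t1 x). Proof. by []. Qed.

Lemma spow1D m x : spow (1 + m) x = t1 (t0 (spow m x)).
Proof.
case: m => [n|[|n]] //; first by rewrite /= t0K t1K.
by have -> : 1 + Negz n.+1 = Negz n; [rewrite !NegzE; lia | rewrite /= t0K t1K].
Qed.

Lemma spowN1D m x : spow (- 1 + m) x = t0 (t1 (spow m x)).
Proof. by rewrite -[in RHS](addKr (-1) m) opprK spow1D t1K t0K. Qed.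

Lemma spowD m n x : spow (m + n) x = spow m (spow n x).
Proof.
elim: m => [|m IH|m IH]; first by rewrite add0r.
  by rewrite intS -addrA !spow1D IH.
by rewrite intS opprD -addrA !spowN1D IH.
Qed.

(** Dihedral relation: conjugation by the reflection t0 inverts sigma. *)
Lemma t0_spow m x : t0 (spow m x) = spow (- m) (t0 x).
Proof.
elim: m => [|m IH|m IH] //.
  by rewrite intS opprD spow1D spowN1D -IH.
by rewrite opprK in IH; rewrite intS opprK opprD spowN1D spow1D -IH !t0K.
Qed.

Lemma spowK m : cancel (spow m) (spow (- m)).
Proof. by move=> x; rewrite -spowD addNr. Qed.

Lemma spowKV m : cancel (spow (- m)) (spow m).
Proof. by move=> x; rewrite -spowD addrN. Qed.

End IterateAutomorphism.

Section LaurentProducts.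
Variables (F : fieldType) (t0 t1 : {rmorphism F -> F}).
Hypotheses (t0K : involutive t0) (t1K : involutive t1).
Variables (R : pzRingType) (Y0 Y1 : F -> R).
(* Y0 and Y1 play the roles of Y_0 and Y_1, where Y_n(a) = a z^n + t0(a) z^-n;
   Y11 says that the degree 2 part of Y1 a * Y1 b only depends on
   a * t1 (t0 b). *)
Hypotheses (Y0B : {morph Y0 : a b / a - b}) (Y1B : {morph Y1 : a b / a - b}).
Hypothesis Y0t : forall a, Y0 (t0 a) = Y0 a.
Hypothesis Y00 : forall a b, Y0 a * Y0 b = Y0 (a * b + t0 a * b).
Hypothesis Y01 : forall a b, Y0 a * Y1 b = Y1 (a * b + t0 a * b).
Hypothesis Y10 : forall a b,
  Y1 a * Y0 b = Y1 (a * t1 (t0 b) + a * t1 b).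
Hypothesis Y11 : forall a b,
  Y1 a * Y1 b - Y0 (a * t1 b) =
  Y1 1 * Y1 (t0 (t1 a) * b) - Y0 (t1 (t0 (t1 a) * b)).

Local Notation s := (spow t0 t1).

(** The recursion is the expected formula for Y_1(1) Y_{n+1}(sigma^-1 x), solved for Y_{n+2}(x). Two
    consecutive degrees are carried to make it structural. *)
Fixpoint lauY_pair n : (F -> R) * (F -> R) :=
  if n is n'.+1 then
    let: (u, v) := lauY_pair n' in
    (v, fun x => Y1 1 * v (s (- 1) x) - u (s (- 2) x))
  else (Y0, Y1).

Definition lauY (n : int) : F -> R :=
  match n with
  | Posz n => (lauY_pair n).1
  | Negz n => fun x => (lauY_pair n.+1).1 (t0 x)
  end.

Arguments lauY : simpl never.

Lemma lauY_rec (n : nat) x :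
  lauY n.+2 x = Y1 1 * lauY n.+1 (s (- 1) x) - lauY n (s (- 2) x).
Proof. by rewrite /lauY /=; case: (lauY_pair n). Qed.

Lemma lauYN n x : lauY (- n) x = lauY n (t0 x).
Proof.
case: n => [[|n]|n]; first by rewrite oppr0 /lauY /= Y0t.
  by rewrite -NegzE.
by rewrite [RHS]/lauY t0K NegzE opprK.
Qed.

Lemma lauYB n : {morph lauY n : a b / a - b}.
Proof.
have Ypos (k : nat) : {morph lauY k : a b / a - b} /\ {morph lauY k.+1 : a b / a - b}.
  elim: k => [|k [IH IH1]]; first by split.
  split=> // a b; rewrite !lauY_rec !raddfB IH IH1 mulrBr.
  by rewrite !opprD !opprK addrACA.
case: n => n a b; first exact: (Ypos n).1.
by rewrite /lauY rmorphB; exact: (Ypos n).2.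
Qed.

HB.instance Definition _ n := GRing.isZmodMorphism.Build F R (lauY n)
  (lauYB n).

Let Zrule (n : int) := forall a b, Y0 a * lauY n b = lauY n (a * b + t0 a * b).
Let Crule (n : int) := forall a b,
  Y1 a * lauY n b = lauY (1 + n) (a * t1 (t0 b)) + lauY (n - 1) (t0 a * t0 (t1 b)).

(** Two-step induction, since the recursion reaches back two degrees; [Y11] gives the base case of
    [Crule] in degree 1. *)
Lemma lauY_base (n : nat) :
  [/\ Zrule n, Zrule n.+1, Crule n & Crule n.+1].
Proof.
have s2 x : s (- 2) x = t0 (t1 (s (- 1) x)) by [].
have sK x : t1 (t0 (s (- 1) x)) = x by rewrite spowN1 t0K t1K.
elim: n => [|n [IHZ0 IHZ1 IHC0 IHC1]].
  split=> // a b.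
  - rewrite sub0r lauYN rmorphM !t0K -[LHS]/(Y1 a * Y0 b) Y10 -[LHS]/(lauY 1 _).
    by rewrite raddfD.
  - have /(canRL (subrK _)) := Y11 a b.
    rewrite -[1 + 1%:Z]/(Posz 2) subrr lauY_rec /lauY /= => ->.
    rewrite !rmorphM !(t0K, t1K); congr (_ - _ + _);
    by rewrite -[LHS]Y0t !rmorphM.
have sub1 (m : nat) : m.+1%:Z - 1 = m by rewrite intS addrC addKr.
have add1 (m : nat) : 1 + m%:Z = m.+1 by rewrite intS.
have C1 a b : Y1 a * lauY n.+1 b = lauY n.+2 (a * t1 (t0 b))
    + lauY n (t0 a * t0 (t1 b)) by rewrite IHC1 sub1 add1.
split=> // [a b|a b].
  rewrite lauY_rec mulrBr mulrA -[Y0 a * _]/(Y0 a * Y1 1) Y01 !mulr1 C1.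
  rewrite IHZ0 -mulrDl (_ : t0 _ * _ = (a + t0 a) * s (- 2) b).
    by rewrite addrK sK mulrDl.
  by rewrite rmorphD t0K s2 [t0 a + a]addrC.
have Y1rec x : Y1 1 * lauY n.+1 (s (- 1) x) = lauY n.+2 x + lauY n (s (- 2) x).
  by rewrite lauY_rec subrK.
have C0 x y : Y1 x * lauY n y = lauY n.+1 (x * t1 (t0 y))
    + lauY (n%:Z - 1) (t0 x * t0 (t1 y)) by rewrite IHC0 add1.
(* [Y11] with b = 1 carries the coefficient a across [Y1 1], leaving left multiplications by [Y1 1],
   which the recursion understands. *)
have sq : Y1 a * Y1 1 = Y1 1 * Y1 (s (- 1) a) - Y0 (s (- 2) a) + Y0 a.
  have /(canRL (subrK _)) := Y11 a 1; rewrite !mulr1 rmorph1 mulr1 => ->.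
  by congr (_ - _ + _); rewrite -Y0t.
rewrite sub1 add1 lauY_rec mulrBr mulrA sq !mulrDl mulNr -mulrA C1.
rewrite !IHZ1 mulrDr !C0 sK.
have -> : s (- 1) a * b = s (- 1) (a * t1 (t0 b)).
  by rewrite rmorphM /= t1K t0K.
rewrite -[Y1 1 * _](addrNK (lauY n.+1 (s (- 2) (a * t1 (t0 b))))) -lauY_rec.
rewrite !rmorph1 !mul1r !s2 !rmorphM /= !(t0K, t1K).
set C := lauY (n%:Z - 1) _.
have zeq (V : zmodType) (A1 A2 B D E G : V) (c : V) :
    A1 + A2 + (B + c) - D + E - (G + c) = A1 + (A2 + B - D + E - G).
  rewrite opprD !addrA (addrAC _ c) (addrAC _ c) (addrAC _ c) addrK.
  by [].
rewrite zeq -!(raddfD, raddfB); congr (_ + lauY _ _). ring.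
Qed.

Lemma lauY0M n a b : Y0 a * lauY n b = lauY n (a * b + t0 a * b).
Proof.
case: n => n; first by have [/(_ a b)] := lauY_base n.
rewrite NegzE lauYN; have [_ -> _ _] := lauY_base n.
by rewrite lauYN; congr (lauY _ _); rewrite rmorphD !rmorphM t0K addrC.
Qed.

Lemma lauY1M n a b : Y1 a * lauY n b =
  lauY (1 + n) (a * t1 (t0 b)) + lauY (n - 1) (t0 a * t0 (t1 b)).
Proof.
case: n => n; first by have [_ _ /(_ a b)] := lauY_base n.
rewrite NegzE lauYN; have [_ _ _ ->] := lauY_base n.
rewrite -[1 - _]opprB -[- _ - 1]opprD !lauYN !rmorphM !t0K addrC.
by rewrite [1 + _]addrC.
Qed.

(** Induction on m by the recursion for [lauY m.+2]: multiplying the case m + 1 by [Y1 1] yields two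
    extra terms, of degrees m + n and n - m, and these are exactly the product for [lauY m]. *)
Lemma lauYM (m : nat) n a b : lauY m a * lauY n b =
  lauY (m%:Z + n) (a * s m b) + lauY (n - m%:Z) (t0 a * s (- m%:Z) b).
Proof.
suff: (forall n a b, lauY m a * lauY n b =
    lauY (m%:Z + n) (a * s m b) + lauY (n - m%:Z) (t0 a * s (- m%:Z) b)) /\
  (forall n a b, lauY m.+1 a * lauY n b =
    lauY (m.+1%:Z + n) (a * s m.+1 b) +
    lauY (n - m.+1%:Z) (t0 a * s (- m.+1%:Z) b)) by case.
elim: m {n a b} => [|m [IH IH1]]; first split=> n a b.
- by rewrite add0r subr0 -raddfD; apply: lauY0M.
- exact: lauY1M.
split=> // n a b; rewrite lauY_rec mulrBl -mulrA IH1 IH mulrDr !lauY1M.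
have -> : 1 + (m.+1%:Z + n) = m.+2%:Z + n by lia.
have -> : m.+1%:Z + n - 1 = m%:Z + n by lia.
have -> : 1 + (n - m.+1%:Z) = n - m%:Z by lia.
have -> : n - m.+1%:Z - 1 = n - m.+2%:Z by lia.
rewrite !rmorph1 !mul1r !rmorphM -!spow1D // -!spowN1D //.
have -> : 1 + m.+1%:Z = m.+2 by lia.
have -> : -1 + m.+1%:Z = m by lia.
have -> : 1 - m.+1%:Z = - m%:Z by lia.
have -> : -1 - m.+1%:Z = - m.+2%:Z by lia.
have -> : t1 (t0 (t0 (s (- 1) a))) = t0 (s (- 2) a) by rewrite /= !t0K.
rewrite (_ : s (- 1 - 1) a = s (- 2) a) // subrr.
have zeq (V : zmodType) (A B C D : V) : A + B + (C + D) - (B + C) = A + D.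
  by rewrite opprD addrACA addrK [X in _ + (X - _)]addrC addrK.
exact: zeq.
Qed.

End LaurentProducts.

Arguments spow : simpl never.

Lemma finite_over_center_fin (R : pzRingType) (I : finType) (b : I -> R) :
  (forall x, exists c : I -> R,
     (forall t, is_central (c t)) /\ x = \sum_t c t * b t) ->
  finite_over_center R.
Proof.
move=> bP; exists #|I|, (fun i => b (enum_val i)) => x.
have [c [cZ ->]] := bP x; exists (fun i => c (enum_val i)); split=> //.
by rewrite (reindex (@enum_val I predT)) //; apply: onW_bij; apply: enum_val_bij.
Qed.

(** * Center and two-sided ideals of the invariant ring *)

Section LaurentInvariants.
Variables (F : fieldType) (t0 t1 : {rmorphism F -> F}).
Hypotheses (t0K : involutive t0) (t1K : involutive t1).
Hypothesis two_neq0 : 2%:R != 0 :> F.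
Variables (R : pzRingType) (Y : int -> F -> R).
Local Notation s := (spow t0 t1).
Hypothesis YB : forall n, {morph Y n : a b / a - b}.
Hypothesis YN : forall n a, Y (- n) a = Y n (t0 a).
Hypothesis YM : forall (m : nat) n a b, Y m a * Y n b =
  Y (m%:Z + n) (a * s m b) + Y (n - m%:Z) (t0 a * s (- m%:Z) b).
Hypothesis Y_half : Y 0 2^-1 = 1.
Hypothesis Y_span : forall P : R -> Prop, P 0 ->
  (forall x y, P x -> P y -> P (x - y)) -> (forall (n : nat) a, P (Y n a)) ->
  forall x, P x.

HB.instance Definition _ n := GRing.isZmodMorphism.Build F R (Y n) (YB n).

(** In the model [Y 0 a] is a + t0 a, so this is the scalar l when t0 fixes l. *)
Let iota l := Y 0 (l / 2).

Lemma iota_mulY l n a : t0 l = l -> iota l * Y n a = Y n (l * a).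
Proof.
move=> lE; rewrite /iota YM add0r subr0 oppr0 !spow0 -raddfD /=; congr (Y _ _).
by rewrite rmorphM fmorphV rmorph_nat lE; field.
Qed.

(** Compared with [iota_mulY], the scalar is twisted by sigma^n: scalars acting on both sides detect
    the degree. *)
Lemma mulY_iota l (n : nat) a : t0 l = l -> Y n a * iota l = Y n (a * s n l).
Proof.
move=> lE; rewrite /iota YM addr0 sub0r YN -raddfD /=; congr (Y _ _).
rewrite !rmorphM t0K /= t0_spow // opprK !fmorphV !rmorph_nat lE.
by field.
Qed.

Lemma central_span z : (forall (n : nat) a, z * Y n a = Y n a * z) -> is_central z.
Proof.
move=> zY; apply: Y_span => [|x y hx hy|] //; first by rewrite mulr0 mul0r.
by rewrite mulrBr mulrBl hx hy.
Qed.

Lemma iota_central l : t0 l = l -> t1 l = l -> is_central (iota l).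
Proof.
move=> l0 l1; apply: central_span => n a; rewrite iota_mulY // mulY_iota //.
have -> : s n l = l; last by rewrite mulrC.
by elim: n => [|n IH] //; rewrite intS spow1D // IH l0 l1.
Qed.

Section FiniteOrder.
Variables (N : nat) (k : {pred F}) (q : nat) (b : 'I_q -> F).
Hypotheses (N_gt0 : (0 < N)%N) (sN : s N =1 id).
Hypotheses (k0 : {in k, t0 =1 id}) (k1 : {in k, t1 =1 id}).
Hypothesis b_span : forall x, exists c : 'I_q -> F,
  (forall t, c t \in k) /\ x = \sum_t c t * b t.

Lemma spowN_period : s (- N%:Z) =1 id.
Proof. by move=> x; rewrite -[in LHS](sN x); apply: spowK. Qed.

Lemma YN_mulY n a : Y N 1 * Y n a = Y (N%:Z + n) a + Y (n - N%:Z) a.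
Proof. by rewrite YM sN spowN_period rmorph1 !mul1r. Qed.

Lemma YN_central : is_central (Y N 1).
Proof.
apply: central_span => n a; rewrite YN_mulY YM !rmorph1 !mulr1 [N%:Z + _]addrC.
by congr (_ + _); rewrite -[N%:Z - _]opprB YN t0K.
Qed.

(** By [YN_mulY], degree n > N is expressed through degrees n - N and n - 2N with the central
    coefficient [Y N 1]. Strong induction ends in degrees at most N, where coefficients are expanded
    along b. *)
Lemma laurent_finite_over_center : finite_over_center R.
Proof.
apply: (@finite_over_center_fin _ ('I_N.+1 * 'I_q)%type (fun u => Y u.1 (b u.2))).
pose P x := exists c : 'I_N.+1 * 'I_q -> R,
  (forall u, is_central (c u)) /\ x = \sum_u c u * Y u.1 (b u.2).
suff: forall x, P x by [].
have P0 : P 0.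
  exists (fun=> 0); split; first by move=> _ x; rewrite mul0r mulr0.
  by rewrite big1 // => u _; rewrite mul0r.
have PB x y : P x -> P y -> P (x - y).
  move=> [c [cZ ->]] [d [dZ ->]]; exists (fun u => c u - d u); split.
    by move=> u z; rewrite mulrBl mulrBr cZ dZ.
  by rewrite -sumrB; apply: eq_bigr => u _; rewrite mulrBl.
have PM z x : is_central z -> P x -> P (z * x).
  move=> zZ [c [cZ ->]]; exists (fun u => z * c u); split.
    by move=> u x'; rewrite -mulrA cZ mulrA zZ mulrA.
  by rewrite mulr_sumr; apply: eq_bigr => u _; rewrite mulrA.
have PS (I : finType) (f : I -> R) : (forall i, P (f i)) -> P (\sum_i f i).
  move=> Pf; apply: big_rec => // i x _ Px.
  by rewrite -[x]opprK -[- x]add0r; apply: (PB) => //; apply: PB.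
have Psmall (m : 'I_N.+1) t : P (Y m (b t)).
  exists (fun u => (u == (m, t))%:R); split=> [u x|].
    by case: (_ == _); rewrite ?mul1r ?mulr1 ?mul0r ?mulr0.
  rewrite (bigD1 (m, t)) //= eqxx mul1r big1 ?addr0 // => u /negPf ->.
  by rewrite mul0r.
apply: Y_span => // n; elim/ltn_ind: n => n IH a.
have [nN|Nn] := leqP n N.
  have [c [ck ->]] := b_span a; rewrite raddf_sum /=; apply: PS => t.
  have [c0 c1] := (k0 (ck t), k1 (ck t)).
  rewrite -iota_mulY //; apply: PM; first exact: iota_central.
  exact: (Psmall (Ordinal (nN : (n < N.+1)%N))).
have -> : Y n a = Y N 1 * Y (n - N)%N a - Y ((n - N)%N%:Z - N%:Z) a.
  by rewrite YN_mulY -PoszD subnKC 1?ltnW // addrK.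
apply: (PB); first by apply: PM; [exact: YN_central | apply: IH; lia].
(* If n < 2N, the negative degree n - 2N is reflected by [YN] to 2N - n, which is still below n. *)
have [le|lt] := leqP N (n - N).
  by rewrite subzn //; apply: IH; lia.
rewrite -opprB YN subzn 1?ltnW //; apply: IH; lia.
Qed.

End FiniteOrder.

Section InfiniteOrder.
Hypothesis s_moves : forall p : nat, (0 < p)%N -> exists2 l, t0 l = l & s p l != l.

(** Each inequality alone is met by some l. A group is not the union of two proper subgroups: if
    neither choice meets both inequalities, the sum of the two does. *)
Lemma spow_separates (m n : nat) : m <> n -> exists l,
  [/\ t0 l = l, s n l != s m l & s n l != s (- m%:Z) l].
Proof.
move=> mn.
have [l1 l1E l1P] : exists2 l, t0 l = l & s n l != s m l.
  wlog lt : m n mn / (m < n)%N => [hw|].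
    have [/hw|/hw|/mn //] := ltngtP m n; first exact.
    by move=> [|l lE]; [move/esym | exists l; rewrite // eq_sym].
  have [|l lE lP] := s_moves (p := n - m); first by rewrite subn_gt0.
  exists l => //; apply: contraNneq lP => e.
  rewrite -(inj_eq (can_inj (spowK t0K t1K m))) -spowD // -e.
  by apply/eqP; congr (spow _ _ _ _); lia.
have [l2 l2E l2P] : exists2 l, t0 l = l & s n l != s (- m%:Z) l.
  have [|l lE lP] := s_moves (p := n + m); first by lia.
  exists l => //; apply: contraNneq lP => e.
  by rewrite -(inj_eq (can_inj (spowK t0K t1K (- m%:Z)))) -spowD // -e; apply/eqP;
    congr (spow _ _ _ _); lia.
have [e1|] := eqVneq (s n l1) (s (- m%:Z) l1); last by exists l1.
have [e2|] := eqVneq (s n l2) (s m l2); last by exists l2.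
exists (l1 + l2); rewrite !rmorphD /= l1E l2E; split=> //.
  by rewrite e2 (inj_eq (addIr _)).
by rewrite e1 (inj_eq (addrI _)).
Qed.

Variable I : R -> Prop.
Hypothesis idealI : two_sided_ideal I.

Lemma ideal_sub x y : I x -> I y -> I (x - y).
Proof. by case: idealI => _ IB _ _; apply: IB. Qed.

Lemma ideal_add x y : I x -> I y -> I (x + y).
Proof.
case: idealI => I0 IB _ _ Ix Iy; rewrite -[y]opprK -[- y]add0r.
by apply: (IB) => //; apply: IB.
Qed.

Lemma ideal_mull a x : I x -> I (a * x).
Proof. by case: idealI => _ _ IM _; apply: IM. Qed.

Lemma ideal_mulr a x : I x -> I (x * a).
Proof. by case: idealI => _ _ _; apply. Qed.

Lemma ideal_Y (n : nat) a : (0 < n)%N -> a != 0 -> I (Y n a) -> I 1.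
Proof.
move=> n_gt0 a0 IY.
(* As t0 (sigma^n l) = sigma^-n l, an l moved by sigma^2n has sigma^n l outside the fixed field of
   t0. *)
have [|l lE lP] := s_moves (p := n + n); first by lia.
have lamP : s n l - t0 (s n l) != 0.
  rewrite t0_spow // lE subr_eq0; apply: contraNneq lP => e.
  by rewrite PoszD spowD // e -spowD // addrN.
set lam := s n l in lamP.
have IYn x : I (Y n x).
  (* k1 and k2 are the coordinates of x / a in the basis 1, lam of F over the fixed field of t0;
     right multiplication by [iota l] supplies the factor lam. *)
  pose y := x / a; pose k2 := (y - t0 y) / (lam - t0 lam); pose k1 := y - k2 * lam.
  have k2E : t0 k2 = k2.
    rewrite /k2 fmorph_div !rmorphB !t0K.
    by rewrite -[t0 y - y]opprB -[t0 lam - lam]opprB invrN mulrNN.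
  have k1E : t0 k1 = k1.
    rewrite /k1 rmorphB [t0 (k2 * _)]rmorphM k2E; apply/eqP; rewrite -subr_eq0.
    have -> : t0 y - k2 * t0 lam - (y - k2 * lam) = k2 * (lam - t0 lam) - (y - t0 y).
      by ring.
    by rewrite /k2 divfK // subrr.
  have -> : x = k1 * a + k2 * a * lam by rewrite /k1 /y; field.
  rewrite raddfD /= -mulY_iota // -!iota_mulY //.
  by apply: ideal_add; [apply: ideal_mull | apply/ideal_mulr/ideal_mull].
(* (b, c) and (1, s (-n) b * c) give the same component of degree n + n. *)
have IYY b c : I (Y 0 ((t0 b - s (- (n + n)%N%:Z) b) * s (- n%:Z) c)).
  have := ideal_sub (ideal_mull (Y n b) (IYn c))
                    (ideal_mull (Y n 1) (IYn (s (- n%:Z) b * c))).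
  rewrite !YM !rmorphM /= rmorph1 !mul1r spowKV //.
  rewrite (_ : s _ (s _ b) = s (- (n + n)%N%:Z) b); last by rewrite -spowD // -opprD.
  have zeq (A B C : R) : A + B - (A + C) = B - C.
    by rewrite opprD addrACA subrr add0r.
  by rewrite zeq subrr -raddfB mulrBl.
have dP : t0 l - s (- (n + n)%N%:Z) l != 0.
  rewrite lE subr_eq0; apply: contraNneq lP => e.
  by rewrite {1}e spowKV.
(* The second argument is chosen to make the coefficient 1/2. *)
have := IYY l (s n (2^-1 / (t0 l - s (- (n + n)%N%:Z) l))).
by rewrite spowK // mulrC divfK // Y_half.
Qed.

(** Induction on the number of nonzero coefficients. The coefficient in degree 0 is required to be
    fixed by t0 because [Y 0 c] vanishes when t0 c = - c, so a nonzero coefficient would not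
    suffice. *)
Lemma ideal_normal_form n (a : nat -> F) : t0 (a 0) = a 0 ->
  I (\sum_(i < n) Y i (a i)) -> (exists2 i, (i < n)%N & a i != 0) -> I 1.
Proof.
have [k] := ubnP #|[set i : 'I_n | a i != 0]|.
elim: k a => // k IH a; rewrite ltnS => ak a0E Ia [j jn aj].
have [m /andP[mj am]|single] := pickP [pred m : 'I_n | (m != j :> nat) && (a m != 0)].
  have [l [lE l1 l2]] := spow_separates (elimN eqP mj).
  (* t0 exchanges s m l and s (-m) l, so the polynomial with these two roots has
     coefficients fixed by t0; applied to right multiplication by iota l, it
     kills the component of degree m. *)
  pose tr := s m l + s (- m%:Z) l; pose nm := s m l * s (- m%:Z) l.
  have trE : t0 tr = tr by rewrite /tr rmorphD !t0_spow // opprK lE addrC.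
  have nmE : t0 nm = nm by rewrite /nm rmorphM !t0_spow // opprK lE mulrC.
  pose phi i := (s i%:Z l - s m l) * (s i%:Z l - s (- m%:Z) l).
  have phiE i : phi i = s i%:Z l * s i%:Z l - tr * s i%:Z l + nm.
    by rewrite /phi /tr /nm; ring.
  have phim : phi m = 0 by rewrite /phi subrr mul0r.
  have phij : phi j != 0 by rewrite mulf_neq0 // subr_eq0.
  clearbody tr nm phi.
  apply: (IH (fun i => a i * phi i)).
  - apply: leq_trans ak; apply: proper_card; apply/properP; split.
      by apply/subsetP => i; rewrite !inE mulf_eq0 negb_or => /andP[].
    by exists m; rewrite !inE // phim mulr0 eqxx.
  - by rewrite phiE spow0 !(rmorphM, rmorphD, rmorphN) a0E lE trE nmE.
  - have -> : \sum_(i < n) Y i (a i * phi i) =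
        (\sum_(i < n) Y i (a i)) * iota l * iota l
        - iota tr * (\sum_(i < n) Y i (a i)) * iota l
        + iota nm * (\sum_(i < n) Y i (a i)).
      rewrite !mulr_sumr !mulr_suml -sumrB -big_split /=; apply: eq_bigr => i _.
      rewrite !(iota_mulY, mulY_iota) // -raddfB -raddfD phiE; congr (Y _ _).
      by ring.
    apply: ideal_add; last exact: ideal_mull.
    apply: ideal_sub; first exact/ideal_mulr/ideal_mulr.
    exact/ideal_mulr/ideal_mull.
  - by exists j => //; rewrite mulf_neq0.
have e : \sum_(i < n) Y i (a i) = Y j (a j).
  rewrite (bigD1 (Ordinal jn)) //= big1 ?addr0 // => i ij.
  have /negbT := single i; rewrite /= negb_and negbK => /orP[/eqP ji|].
    by case/eqP: ij; apply: val_inj.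
  by rewrite negbK => /eqP ->; rewrite raddf0.
move: Ia; rewrite e; case: j aj {jn single e} => [|j] aj; last exact: ideal_Y.
(* In degree 0 the surviving coefficient is fixed by t0, so its inverse is an available scalar. *)
move=> /(ideal_mulr (iota (2^-1 / a 0))).
rewrite mulY_iota ?fmorph_div ?a0E ?fmorphV ?rmorph_nat //=.
by rewrite mulrC divfK // Y_half.
Qed.

Lemma laurent_normal_form x : exists n (a : nat -> F),
  t0 (a 0) = a 0 /\ x = \sum_(i < n) Y i (a i).
Proof.
have widen n n' (a : nat -> F) : (n <= n')%N ->
    \sum_(i < n) Y i (a i) = \sum_(i < n') Y i (if (i < n)%N then a i else 0).
  move=> le; rewrite -(big_mkord predT (fun i => Y i (a i))).
  rewrite -(big_mkord predT (fun i => Y i (if (i < n)%N then a i else 0))).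
  rewrite [RHS](big_cat_nat (n := n)) //= [X in _ + X]big1_seq ?addr0.
    by apply: eq_big_nat => i /andP[_ ->].
  by move=> i; rewrite mem_index_iota => /andP[_ /andP[/leq_gtF -> _]]; rewrite raddf0.
move: x; apply: Y_span => [|x y [n [a [aE ->]]] [n' [a' [aE' ->]]]|n a].
- by exists 0, (fun=> 0); rewrite rmorph0 big_ord0.
- exists (maxn n n'), (fun i => (if (i < n)%N then a i else 0)
                              - (if (i < n')%N then a' i else 0)); split.
    by rewrite rmorphB; do 2!case: ifP; rewrite ?rmorph0 ?aE ?aE'.
  rewrite (widen n (maxn n n')) ?leq_maxl // (widen n' (maxn n n')) ?leq_maxr //.
  by rewrite -sumrB; apply: eq_bigr => i _; rewrite raddfB.
(* Averaging over t0 in degree 0 does not change the value of [Y 0]. *)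
pose a' := if n == 0 then (a + t0 a) / 2 else a.
exists n.+1, (fun i => if i == n then a' else 0); split.
  rewrite /a' {a'}; case: n => [|n] /=; last by rewrite rmorph0.
  by rewrite fmorph_div rmorphD t0K rmorph_nat addrC.
rewrite big_ord_recr /= eqxx big1 ?add0r => [|i _]; last first.
  by rewrite ltn_eqF // raddf0.
rewrite /a' {a'}; case: n => [|n] //=.
rewrite mulrDl raddfD /= -[t0 a / 2](_ : t0 (a / 2) = _).
  by rewrite -YN oppr0 -raddfD /=; congr (Y _ _); field.
by rewrite fmorph_div rmorph_nat.
Qed.

End InfiniteOrder.

Lemma laurent_simple :
    (forall p : nat, (0 < p)%N -> exists2 l, t0 l = l & s p l != l) ->
  (1 : R) <> 0 -> simple_ring R.
Proof.
move=> s_moves R1; split=> // I idI.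
have [[x Ix x0]|noI] := pselect (exists2 x, I x & x <> 0); last first.
  by left=> x Ix; apply: contrapT => x0; apply: noI; exists x.
right=> y; rewrite -[y]mulr1; apply: ideal_mull => //.
have [n [a [aE xE]]] := laurent_normal_form x.
apply: (ideal_normal_form s_moves idI aE (n := n)); first by rewrite -xE.
apply: contrapT => noa; apply: x0; rewrite xE big1 // => i _.
have [->|ai] := eqVneq (a i) 0; first by rewrite raddf0.
by case: noa; exists i.
Qed.

End LaurentInvariants.

(** * The degree 2 relation between products of [Y1] *)

Section QuadraticRelation.
Variables (F : fieldType) (t0 t1 : {rmorphism F -> F}).
Hypotheses (t0K : involutive t0) (t1K : involutive t1).
Hypothesis two_neq0 : 2%:R != 0 :> F.
Variables (d0 d1 : F).
Hypotheses (d0_neq0 : d0 != 0) (d1_neq0 : d1 != 0).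
Hypotheses (t0d0 : t0 d0 = - d0) (t1d1 : t1 d1 = - d1).
Variables (R : pzRingType) (Y0 Y1 : F -> R) (V : F -> F -> R).
Hypotheses (Y0B : {morph Y0 : a b / a - b}) (Y1B : {morph Y1 : a b / a - b}).
Hypothesis Y00 : forall a b, Y0 a * Y0 b = Y0 (a * b + t0 a * b).
Hypothesis Y01 : forall a b, Y0 a * Y1 b = Y1 (a * b + t0 a * b).
Hypothesis Y10 : forall a b,
  Y1 a * Y0 b = Y1 (a * t1 (t0 b) + a * t1 b).
(* V a b stands for x_0(a) x_1(b) g_0^-1. *)
Hypothesis V4 : forall a b,
  V a b *+ 4 = Y0 (a * b / d0) + Y1 (a * t1 (b / d0)).
Hypothesis VV : forall a b c d,
  V a b * V c d = V a (b * t0 (c * (d1 / d0))) * V (d0 / d1) d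
  + V (a * ((b * (c * (d1 / d0) - t0 (c * (d1 / d0))) / 2
            - t1 (b * (c * (d1 / d0) - t0 (c * (d1 / d0))) / 2)) / (2 * d1))) d.

HB.instance Definition _ := GRing.isZmodMorphism.Build F R Y0 Y0B.
HB.instance Definition _ := GRing.isZmodMorphism.Build F R Y1 Y1B.

(** This is 16 times [VV] at b = d = d0, expanded by [V4]: products with a factor [Y0] are known,
    and [zeq] collects the terms in [Y0] and in [Y1] separately. The second factor d0 / d1 is the
    one produced by [VV], and v is the first factor for which both sides have the degree 2
    coefficient a sigma(c). *)
Lemma quadratic_relation_pivot a c (v := a * t1 (t0 (c * (d1 / d0)))) :
  Y1 a * Y1 c - Y0 (a * t1 c) = Y1 v * Y1 (d0 / d1) - Y0 (v * t1 (d0 / d1)).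
Proof.
have V4d x : V x d0 *+ 4 = Y0 x + Y1 x.
  by rewrite V4 divff // rmorph1 mulr1 mulfK.
pose y := d0 * (c * (d1 / d0) - t0 (c * (d1 / d0))) / 2.
pose pi := (y - t1 y) / (2 * d1).
have VVpi : V a d0 * V c d0 =
    V a (d0 * t0 (c * (d1 / d0))) * V (d0 / d1) d0 + V (a * pi) d0 by exact: VV.
have : (V a d0 *+ 4) * (V c d0 *+ 4) = (V a (d0 * t0 (c * (d1 / d0))) *+ 4)
    * (V (d0 / d1) d0 *+ 4) + V (a * pi) d0 *+ 4 *+ 4.
  by rewrite !(mulrnAl, mulrnAr) VVpi -!mulrnA mulrnDl.
rewrite !V4d V4 [d0 * _ / d0]mulrAC divff // mul1r -/v.
set u := a * (d0 * _) / d0.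
have uE : u = a * t0 (c * (d1 / d0)) by rewrite /u mulrCA mulrAC divff // mul1r.
rewrite mulrnDl -!raddfMn /=.
rewrite !mulrDl !mulrDr !Y00 !Y01 !Y10.
have zeq (P Q p q y1 y2 y3 a1 a2 b1 b2 b3 : R) :
    y2 + y3 = y1 + (p - q) -> b1 + b2 + b3 = a1 + a2 ->
    y1 + a1 + (a2 + P) = y2 + b1 + (b2 + Q) + (y3 + b3) -> P - p = Q - q.
  move=> ey eb; rewrite [LHS](AC (2*2) (1*(2*3)*4)).
  rewrite [RHS](AC (2*2*2) ((1*5)*(2*3*6)*4)) /= ey eb.
  rewrite [RHS](AC (2*1*1) (1*3*(2*4))) => /addrI ->.
  by rewrite addrAC [p - q]addrC addrK addrC.
have [t1d0 t0d1] : t1 d0 != 0 /\ t0 d1 != 0 by rewrite !fmorph_eq0.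
have t1t0d1 : t1 (t0 d1) != 0 by rewrite !fmorph_eq0.
have mE := (rmorphM, rmorphB, fmorphV, t0K, t1K, t0d0, t1d1, rmorphN, rmorph_nat).
apply: zeq; rewrite -!(raddfD, raddfB) /=; congr (_ _).
  rewrite uE /v /pi /y !mE; field.
  by rewrite !oppr_eq0 d0_neq0 d1_neq0 two_neq0 t1d0.
rewrite uE /v /pi /y !mE; field.
by rewrite !oppr_eq0 d0_neq0 d1_neq0 two_neq0 t1d0.
Qed.

(** Both products have the degree 2 coefficient a sigma(b), hence the same pivot form. *)
Lemma quadratic_relation a b :
  Y1 a * Y1 b - Y0 (a * t1 b) =
  Y1 1 * Y1 (t0 (t1 a) * b) - Y0 (t1 (t0 (t1 a) * b)).
Proof.
have e : a * t1 (t0 (b * (d1 / d0))) = 1 * t1 (t0 (t0 (t1 a) * b * (d1 / d0))).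
  by rewrite mul1r -mulrA [in RHS]rmorphM t0K [in RHS]rmorphM t1K.
by rewrite -[t1 (t0 (t1 a) * b)]mul1r [LHS]quadratic_relation_pivot e
  [RHS]quadratic_relation_pivot.
Qed.

End QuadraticRelation.

(** * Consequences of the relations of Lambda *)

Local Notation "x ** y" := (zmul x y) (at level 40, left associativity).

Lemma int_ind2 (Q : int -> Prop) : Q 0 -> Q 1 ->
  (forall i, Q i -> Q (i + 2)) -> (forall i, Q (i + 2) -> Q i) -> forall i, Q i.
Proof.
move=> Q0 Q1 Qup Qdown i.
have Qpos (n : nat) : Q n /\ Q n.+1.
  elim: n => [|n [IH IH1]]; split=> //.
  by rewrite (_ : n.+2%:Z = n%:Z + 2); [apply: Qup | lia].
have Qneg (n : nat) : Q (- n%:Z) /\ Q (1 - n%:Z).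
  elim: n => [|n [IH IH1]]; split=> //.
    by apply: Qdown; rewrite (_ : - n.+1%:Z + 2 = 1 - n%:Z) //; lia.
  by rewrite (_ : 1 - n.+1%:Z = - n%:Z) //; lia.
case: i => n; first exact: (Qpos n).1.
by rewrite NegzE; apply: (Qneg n.+1).1.
Qed.

Section StepFamily.
Variables (P : int -> Type) (up : forall i, P i -> P (i + 2)).
Variables (down : forall i, P (i + 2) -> P i).
Hypothesis downK : forall i, cancel (@down i) (@up i).
Variables (p0 : P 0) (p1 : P 1).

Lemma step_posE (n : nat) : n%:Z + 2 = n.+2%:Z. Proof. by lia. Qed.

Lemma step_negE (n : nat) : Negz n = Negz n.+2 + 2.
Proof. by rewrite !NegzE; lia. Qed.

Fixpoint step_pos (n : nat) : P n :=
  match n return P n with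
  | 0%N => p0
  | 1%N => p1
  | n'.+2 => ecast z (P z) (step_posE n') (up (step_pos n'))
  end.

Fixpoint step_neg (n : nat) : P (Negz n) :=
  match n return P (Negz n) with
  | 0%N => @down (Negz 0) p1
  | 1%N => @down (Negz 1) p0
  | n'.+2 => down (ecast z (P z) (step_negE n') (step_neg n'))
  end.

(** Prolongs values at 0 and 1 to all integers by steps of two, without casts in the resulting
    equation [step_familyD]; it will provide the products of the [g i] and of their inverses. *)
Definition step_family (i : int) : P i :=
  match i return P i with Posz n => step_pos n | Negz n => step_neg n end.

Lemma step_family_cast i j (e : i = j) :
  ecast z (P z) e (step_family i) = step_family j.
Proof. by case: j / e. Qed.

Lemma step_familyD i : step_family (i + 2) = up (step_family i).
Proof.
case: i => [n|[|[|n]]].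
- by rewrite -(step_family_cast (esym (step_posE n))) /=; case: _ / (step_posE n).
- by rewrite -[RHS]/(up (@down (Negz 0) p1)) downK.
- by rewrite -[RHS]/(up (@down (Negz 1) p0)) downK.
- by rewrite -(step_family_cast (step_negE n)) /= downK.
Qed.

End StepFamily.

(** * Normality of the g_i and generation by loops *)

Section GeneratedZalg.
Variables (F : fieldType) (tau : int -> {rmorphism F -> F}) (w : int -> F).
Hypothesis two_neq0 : 2%:R != 0 :> F.
Hypothesis tauK : forall i, involutive (tau i).
Hypothesis tau2 : forall i, tau (i + 2) = tau i.
Hypothesis tauw : forall i, tau i (w i) = - w i.
Hypothesis w_neq0 : forall i, w i != 0.
Hypothesis w_moved : forall i, tau i (w (i + 1)) != w (i + 1).

Variables (C : zalg) (io : forall i, F -> C i i) (X : forall i j, F -> C i j).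
Variables (g : forall i, C i (i + 2)) (gi : forall i, C (i + 2) i).
(* X i j is only meaningful for j = i + 1; the free index j avoids casts between
   C i (i + 1 + 1) and C i (i + 2). *)
Hypothesis ioB : forall i a b, tau i a = a -> tau i b = b ->
  io i (a - b) = io i a - io i b.
Hypothesis io1 : forall i, io i 1 = zone i.
Hypothesis ioM : forall i a b, tau i a = a -> tau i b = b ->
  io i (a * b) = io i a ** io i b.
Hypothesis XB : forall i j, {morph X i j : a b / a - b}.
Hypothesis ioX : forall i j k a, tau i k = k -> io i k ** X i j a = X i j (k * a).
Hypothesis Xio : forall i j a k, tau j k = k -> X i j a ** io j k = X i j (a * k).
Hypothesis hrel : forall i j, j = i + 1 ->
  X i j 1 ** X j (i + 2) 1 + X i j (w j)^-1 ** X j (i + 2) (w j) = 0.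
Hypothesis grel : forall i j, j = i + 1 ->
  g i = X i j (w j) ** X j (i + 2) 1 + X i j 1 ** X j (i + 2) (w j).
Hypothesis ggi : forall i, g i ** gi i = zone i.
Hypothesis gig : forall i, gi i ** g i = zone (i + 2).

HB.instance Definition _ i j := GRing.isZmodMorphism.Build F (C i j) (X i j) (@XB i j).

(** The component of w_{i+1} on which tau_i acts as -1. *)
Definition delta i := (w (i + 1) - tau i (w (i + 1))) / 2.
(** The coefficient of w_{i+1} when u is written in the basis 1, w_{i+1} of F over the fixed field
    of tau_i. *)
Definition gcoef i u := (u - tau i u) / (2 * delta i).

Lemma delta_neq0 i : delta i != 0.
Proof. by rewrite mulf_neq0 ?invr_neq0 // subr_eq0 eq_sym. Qed.

Lemma tau_delta i : tau i (delta i) = - delta i.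
Proof. by rewrite fmorph_div rmorphB tauK rmorph_nat -mulNr opprB. Qed.

Lemma tau_gcoef i u : tau i (gcoef i u) = gcoef i u.
Proof.
rewrite fmorph_div rmorphB rmorphM tauK rmorph_nat tau_delta.
by rewrite mulrN invrN mulrN -mulNr opprB.
Qed.

Lemma mulX_w i j l a p m : tau j p = p -> tau j m = m ->
  X i j a ** X j l (p + w j * m) =
  X i j (a * p) ** X j l 1 + X i j (a * m) ** X j l (w j).
Proof.
move=> pE mE; rewrite raddfD zmulDr -!Xio // -!zmulA !ioX // mulr1.
by rewrite [m * _]mulrC.
Qed.

(* u h_i, when j = i + 1 and l = i + 2. *)
Definition h_mul i j l u : C i l := X i j u ** X j l 1 + X i j (u / w j) ** X j l (w j).

Lemma h_mulB i j l : {morph h_mul i j l : u v / u - v}.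
Proof.
move=> u v; rewrite /h_mul mulrBl !raddfB !zmulBl opprD.
by rewrite addrACA.
Qed.
HB.instance Definition _ i j l :=
  GRing.isZmodMorphism.Build F (C i l) (h_mul i j l) (@h_mulB i j l).

Lemma tau_decomp j b : exists p m, [/\ tau j p = p, tau j m = m,
   b = p + w j * m & tau j b = p - w j * m].
Proof.
exists ((b + tau j b) / 2), ((b - tau j b) / (2 * w j)); have w0 := w_neq0 j.
rewrite !fmorph_div rmorphD rmorphB rmorphM tauK rmorph_nat tauw; split.
- by rewrite addrC.
- by field; rewrite ?oppr_eq0 w0 two_neq0.
- by field; rewrite w0 two_neq0.
- by field; rewrite w0 two_neq0.
Qed.

(** Write b = p + w_j m with p and m fixed by tau_j. Modulo multiples of h, moving w_j m to the
    first factor changes its sign, so b arrives there as tau_j b. *)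
Lemma mulX_split i j l a b : X i j a ** X j l b =
  X i j (a * tau j b) ** X j l 1 + h_mul i j l (a * (b - tau j b) / 2).
Proof.
have [p [m [pE mE bE tbE]]] := tau_decomp j b; have w0 := w_neq0 j.
rewrite {1}bE mulX_w // /h_mul addrA -zmulDl -raddfD /= tbE.
congr (X i j _ ** _ + X i j _ ** _).
  by rewrite bE; field.
by rewrite bE; field; rewrite ?w0 two_neq0.
Qed.

(** The right side is u h b, so h commutes with F: multiplication by w_j exchanges the two terms of
    h up to w_j^2, which is fixed by tau_j. *)
Lemma h_mul_mul i j l u b :
  h_mul i j l (u * b) = X i j u ** X j l b + X i j (u / w j) ** X j l (w j * b).
Proof.
have w2 : tau j (w j ^+ 2) = w j ^+ 2 by rewrite rmorphXn tauw sqrrN.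
have [p [m [pE mE -> _]]] := tau_decomp j b; have w0 := w_neq0 j.
have -> : w j * (p + w j * m) = w j ^+ 2 * m + w j * p by ring.
have w2m : tau j (w j ^+ 2 * m) = w j ^+ 2 * m by rewrite rmorphM w2 mE.
rewrite !mulX_w // /h_mul [RHS]addrACA -!zmulDl -!raddfD /=.
by congr (X i j _ ** _ + X i j _ ** _); field.
Qed.

Lemma io_h_mul i j l k u : tau i k = k -> io i k ** h_mul i j l u = h_mul i j l (k * u).
Proof. by move=> kE; rewrite /h_mul zmulDr !zmulA !ioX // mulrA. Qed.

(** In the basis 1, w_{i+1}, the first component of u contributes a multiple of h_i = 0 and the
    second a multiple of w_{i+1} h_i = g_i. *)
Lemma h_mul_g i j u : j = i + 1 -> h_mul i j (i + 2) u = io i (gcoef i u) ** g i.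
Proof.
move=> jE; have d0 := delta_neq0 i; have w0 := w_neq0 j.
have uE : u = (u - gcoef i u * w j) * 1 + gcoef i u * w j by rewrite mulr1 subrK.
have kE : tau i (u - gcoef i u * w j) = u - gcoef i u * w j.
  rewrite rmorphB rmorphM tau_gcoef; apply/eqP; rewrite -subr_eq0; apply/eqP.
  have -> : tau i u - gcoef i u * tau i (w j) - (u - gcoef i u * w j) =
    gcoef i u * (2 * delta i) - (u - tau i u) by rewrite jE /delta; field.
  by rewrite /gcoef divfK ?subrr // mulf_neq0.
rewrite {1}uE raddfD /= -!io_h_mul // ?tau_gcoef //.
by rewrite /h_mul div1r hrel // zmul0r add0r divff // -grel.
Qed.

Lemma g_io i k : tau i k = k -> g i ** io (i + 2) k = io i k ** g i.
Proof.
move=> kE; have w0 := w_neq0 (i + 1); rewrite (grel erefl) zmulDl zmulDr.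
rewrite -!zmulA !Xio ?tau2 // !zmulA !ioX // mul1r !mulr1.
have := h_mul_mul i (i + 1) (i + 2) (w (i + 1)) k; rewrite divff // => <-.
by rewrite /h_mul mulrC mulfK.
Qed.

(** Normality of the g_i comes from associativity of products of three arrows: after regrouping, the
    terms starting with x_i(u) contain the factor h_j = 0, and the others form x_i(u / w_j) w_j
    h_j. *)
Lemma g_X i j u : j = i + 1 ->
  g i ** X (i + 2) (j + 2) (u / delta i) = X i j (u / delta j) ** g j.
Proof.
move=> jE; have w0 := w_neq0 j; have v0 := w_neq0 (i + 2).
have [d0 d0'] := (delta_neq0 i, delta_neq0 j).
have jE2 : i + 2 = j + 1 by rewrite jE -addrA.
set v := w (i + 2) in v0.
have tv : tau i v = - v by rewrite -tauw tau2.
(* tau_i negates w_{i+2}, so 1 and w_{i+2} also form a basis over its fixed field. *)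
have uE : u / delta i = 1 * gcoef i u + v * gcoef i (u / v).
  by rewrite /gcoef fmorph_div tv; field; rewrite ?oppr_eq0 d0 v0 two_neq0.
have gX k a : tau i k = k ->
    g i ** X (i + 2) (j + 2) (a * k) = io i k ** g i ** X (i + 2) (j + 2) a.
  by move=> kE; rewrite -g_io // -zmulA ioX ?tau2 // mulrC.
rewrite uE raddfD /= zmulDr !gX ?tau_gcoef // -!(h_mul_g _ jE) //.
have -> : u / delta j = u / w j * gcoef j (w j).
  by rewrite /gcoef tauw; field; rewrite d0' w0 two_neq0.
rewrite -Xio ?tau_gcoef // -zmulA -(h_mul_g _ jE2) //.
rewrite h_mul_mul zmulDl -[RHS]add0r -(zmul0r _ (X i j u)) -(hrel jE2).
rewrite /h_mul !zmulDl !zmulDr !zmulA.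
exact: addrACA.
Qed.

Lemma gi_X i j a : j = i + 1 ->
  gi i ** X i j a = X (i + 2) (j + 2) (a * (delta j / delta i)) ** gi j.
Proof.
move=> jE; have := g_X (a * delta j) jE.
rewrite mulfK ?delta_neq0 // -[_ * _ / _]mulrA => e.
rewrite -[X i j a]zmul1r -(ggi j) [X i j a ** _]zmulA -e.
by rewrite !zmulA gig zmul1l.
Qed.

Lemma gi_io i k : tau i k = k -> gi i ** io i k = io (i + 2) k ** gi i.
Proof.
move=> kE; rewrite -[io i k]zmul1r -(ggi i) [io i k ** _]zmulA -g_io //.
by rewrite !zmulA gig zmul1l.
Qed.

Hypothesis gen : forall P : forall i, C i 0 -> Prop,
  (forall i, P i 0) -> (forall i x y, P i x -> P i y -> P i (x - y)) ->
  P 0 (zone 0) ->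
  (forall i k x, tau i k = k -> P i x -> P i (io i k ** x)) ->
  (forall i j a x, j = i + 1 -> P j x -> P i (X i j a ** x)) ->
  (forall i x, P i x -> P (i + 2) (gi i ** x)) -> forall i x, P i x.

Definition loop a b : C 0 0 := X 0 1 a ** X 1 (0 + 2) b ** gi 0.

(** The g_i and their inverses can be carried past every arrow, until consecutive arrows of a path
    pair up into loops at 0. *)
Lemma generation (G : C 0 0 -> Prop) : G 0 ->
  (forall x y, G x -> G y -> G (x - y)) -> G (zone 0) ->
  (forall k x, tau 0 k = k -> G x -> G (io 0 k ** x)) ->
  (forall a b x, G x -> G (loop a b ** x)) -> forall x, G x.
Proof.
move=> G0 GB G1 Gio Gloop.
have mulgK l i : cancel (fun x : C l (i + 2) => x ** gi i) (fun x : C l i => x ** g i).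
  by move=> x; rewrite -zmulA gig zmul1r.
(* q i = g_0 g_2 ... g_{i-2} for even i and 0 for odd i; r i = g_1 g_3 ... g_{i-2}
   for odd i and 0 for even i (with inverses for negative i).  They bring a path
   from i to 0 back to loops at 0. *)
pose fam l (p0 : C l 0) (p1 : C l 1) := step_family (P := fun i => C l i : Type)
  (fun i x => x ** g i) (fun i x => x ** gi i) p0 p1.
pose q : forall i, C 0 i := fam 0 (zone 0) 0.
pose r : forall i, C 1 i := fam 1 0 (zone 1).
have qD i : q (i + 2) = q i ** g i by apply: (step_familyD (mulgK 0)).
have rD i : r (i + 2) = r i ** g i by apply: (step_familyD (mulgK 1)).
have [q0 q1 r0 r1] : [/\ q 0 = zone 0, q 1 = 0, r 0 = 0 & r 1 = zone 1] by [].
clearbody q r; clear fam.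
have qV i : q i = q (i + 2) ** gi i by rewrite qD -zmulA ggi zmul1r.
have rV i : r i = r (i + 2) ** gi i by rewrite rD -zmulA ggi zmul1r.
have qX i j a : j = i + 1 -> exists a', q i ** X i j a = X 0 1 a' ** r j.
  move=> jE; move: i j jE a; apply: int_ind2 => [||i IH|i IH] j jE a.
  - by subst j; exists a; rewrite q0 zmul1l r1 zmul1r.
  - by exists 0; rewrite q1 raddf0 !zmul0l.
  - have [a' a'E] := IH _ erefl (a * delta i / delta (i + 1)).
    exists a'; rewrite (_ : j = i + 1 + 2); last by rewrite jE addrAC.
    rewrite rD zmulA -a'E qD -!zmulA -g_X // mulfK ?delta_neq0 //.
  - have jE2 : j + 2 = i + 2 + 1 by rewrite jE addrAC.
    have [a' a'E] := IH (j + 2) jE2 (a * (delta j / delta i)).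
    by exists a'; rewrite rV qV -zmulA gi_X // !zmulA a'E.
have rX i j a : j = i + 1 -> exists a', r i ** X i j a = X 1 (0 + 2) a' ** gi 0 ** q j.
  move=> jE; move: i j jE a; apply: int_ind2 => [||i IH|i IH] j jE a.
  - by exists 0; rewrite r0 raddf0 !zmul0l.
  - subst j; exists a; rewrite r1 zmul1l -[q _]/(q (0 + 2)) qD q0 zmul1l.
    by rewrite -zmulA gig zmul1r.
  - have [a' a'E] := IH _ erefl (a * delta i / delta (i + 1)).
    exists a'; rewrite (_ : j = i + 1 + 2); last by rewrite jE addrAC.
    by rewrite qD zmulA -a'E rD -!zmulA -g_X // mulfK ?delta_neq0.
  - have jE2 : j + 2 = i + 2 + 1 by rewrite jE addrAC.
    have [a' a'E] := IH (j + 2) jE2 (a * (delta j / delta i)).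
    by exists a'; rewrite qV rV -zmulA gi_X // !zmulA a'E.
have qio i k : tau i k = k -> exists2 k', tau 0 k' = k' & q i ** io i k = io 0 k' ** q i.
  move: i k; apply: int_ind2 => [||i IH|i IH] k kE.
  - by exists k; rewrite // q0 zmul1l zmul1r.
  - by exists 1; rewrite ?rmorph1 // q1 zmul0l zmul0r.
  - rewrite tau2 in kE; have [k' k'E e] := IH k kE; exists k' => //.
    by rewrite qD -zmulA g_io // !zmulA e.
  - have [|k' k'E e] := IH k; first by rewrite tau2.
    by exists k' => //; rewrite qV -zmulA gi_io // !zmulA e.
have rio i k a : tau i k = k ->
    exists a', X 0 1 a ** r i ** io i k = X 0 1 a' ** r i.
  move: i k; apply: int_ind2 => [||i IH|i IH] k kE.
  - by exists 0; rewrite r0 !zmul0r zmul0l.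
  - by exists (a * k); rewrite r1 !zmul1r Xio.
  - rewrite tau2 in kE; have [a' e] := IH k kE; exists a'.
    by rewrite rD zmulA -zmulA g_io // !zmulA e.
  - have [|a' e] := IH k; first by rewrite tau2.
    by exists a'; rewrite rV zmulA -zmulA gi_io // !zmulA e.
(* Only one half has content for each parity, q or r being 0: from an even i the path is transported
   to start at 0, from an odd i it completes a pending arrow x_0(a). *)
pose P i (z : C i 0) := G (q i ** z) /\ forall a, G (X 0 1 a ** r i ** z).
suff PP i z : P i z by move=> x; have [] := PP 0 x; rewrite q0 zmul1l.
move: i z; apply: gen => [i|i x y [qx rx] [qy ry]||i k x kE [qx rx]|i j a x jE [qx rx]|i x [qx rx]].
- by split=> [|a]; rewrite !zmul0r.
- by split=> [|a]; rewrite zmulBr; apply: GB.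
- by split=> [|a]; rewrite ?q0 ?r0 ?zmul0r ?zmul0l ?zmul1l.
- split=> [|b]; rewrite zmulA.
    by have [k' k'E ->] := qio i k kE; rewrite -zmulA; apply: Gio.
  by have [b' ->] := rio i k b kE.
- split=> [|b]; rewrite zmulA.
    by have [a' ->] := qX i j a jE.
  rewrite -[X in X ** x]zmulA; have [a' ->] := rX i j a jE.
  by rewrite !zmulA -[_ ** gi 0]/(loop b a') -zmulA; apply: Gloop.
- by split=> [|a]; rewrite zmulA; [rewrite -qV | rewrite -[X in X ** x]zmulA -rV].
Qed.

Local Notation t0 := (tau 0).
Local Notation t1 := (tau 1).
Local Notation R := (zdiag C 0).

(** The element Y_0(a) of the model. *)
Definition trace_elt a : R := io 0 (a + t0 a).

Lemma trace_eltB : {morph trace_elt : a b / a - b}.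
Proof.
move=> a b; rewrite /trace_elt rmorphB addrACA -opprD ioB //.
  by rewrite rmorphD tauK addrC.
by rewrite rmorphD tauK addrC.
Qed.
HB.instance Definition _ := GRing.isZmodMorphism.Build F R trace_elt trace_eltB.

Lemma trace_elt_tau a : trace_elt (t0 a) = trace_elt a.
Proof. by rewrite /trace_elt tauK addrC. Qed.

Lemma io_trace k : t0 k = k -> io 0 k = trace_elt (k / 2).
Proof.
move=> kE; rewrite /trace_elt fmorph_div kE rmorph_nat; congr (io _ _).
by field.
Qed.

Lemma loop_linear b : {morph loop^~ b : a a' / a - a'}.
Proof. by move=> a a'; rewrite /loop raddfB !zmulBl. Qed.

Definition loop_left b a := loop a b.
HB.instance Definition _ b :=
  GRing.isZmodMorphism.Build F (C 0 0) (loop_left b) (loop_linear b).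

(* In the model, x_0(a) x_1(b) g_0^-1 acts on K_0 as
   (Y_0(ab/delta_0) + Y_1(a t1(b/delta_0))) / 4; take b = delta_0. *)
Definition degree1_elt a : R := (loop a (delta 0) : R) *+ 4 - trace_elt a.

Lemma degree1_eltB : {morph degree1_elt : a b / a - b}.
Proof.
move=> a b; rewrite /degree1_elt loop_linear raddfB mulrnBl !opprD !opprK.
by rewrite addrACA.
Qed.
HB.instance Definition _ := GRing.isZmodMorphism.Build F R degree1_elt degree1_eltB.

Lemma loop_split a b :
  loop a b = loop (a * t1 b) 1 + io 0 (gcoef 0 (a * (b - t1 b) / 2)).
Proof.
rewrite {1}/loop mulX_split zmulDl (h_mul_g _ (erefl : 1 = 0 + 1 :> int)).
by rewrite -[_ ** g 0 ** _]zmulA ggi zmul1r.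
Qed.

(** For b = delta_0 this is the definition of [degree1_elt]. In general [loop_split] reduces both
    sides to the same loop with second entry 1, and an identity between scalars remains. *)
Lemma loop_degree1 a b : (loop a b : R) *+ 4 =
  trace_elt (a * b / delta 0) + degree1_elt (a * t1 (b / delta 0)).
Proof.
have [d0 t1d0] : delta 0 != 0 /\ t1 (delta 0) != 0 by rewrite fmorph_eq0 delta_neq0.
set z := a * b / delta 0 - a * t1 (b / delta 0).
rewrite /degree1_elt addrCA -raddfB /= -/z loop_split [loop _ (delta 0)]loop_split.
rewrite !io_trace ?tau_gcoef //.
have -> : a * t1 (b / delta 0) * t1 (delta 0) = a * t1 b.
  by rewrite fmorph_div mulrA divfK.
have zeq (A x y : R) : A + x - (A + y) = x - y by rewrite opprD addrACA subrr add0r.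
apply/eqP; rewrite addrC -subr_eq -mulrnBl zeq -raddfB -raddfMn /=; apply/eqP.
rewrite -[trace_elt z](_ : trace_elt ((z + t0 z) / 2) = _); last first.
  rewrite mulrDl raddfD -[t0 z / 2](_ : t0 (z / 2) = _) /=.
    by rewrite trace_elt_tau -raddfD; congr (trace_elt _); field.
  by rewrite fmorph_div rmorph_nat.
congr (trace_elt _).
have t0t1d0 : t0 (t1 (delta 0)) != 0 by rewrite fmorph_eq0.
rewrite /gcoef /z; move: (delta 0) (tau_delta 0) d0 t1d0 t0t1d0 => D tD d0 t1d0 t0t1d0.
rewrite !(rmorphM, rmorphB, fmorphV, tD, rmorph_nat); field.
by rewrite oppr_eq0 d0 t1d0 two_neq0 t0t1d0.
Qed.

(** The inner g_0^-1 moves past x_0(c), and [mulX_split] applies to the middle product x_1(b)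
    x_2(c'). Its h part is a multiple of g_1, which cancels g_1^-1; in the other part g_1^-1 moves
    back to recreate a loop. *)
Lemma loop_mul a b c d (c' := c * (delta 1 / delta 0)) :
  loop a b ** loop c d = loop a (b * t0 c') ** loop (delta 0 / delta 1) d
  + loop (a * gcoef 1 (b * (c' - t0 c') / 2)) d.
Proof.
have [d0 d1] := (delta_neq0 0, delta_neq0 1).
rewrite /loop !zmulA -[_ ** gi 0 ** X 0 1 c]zmulA gi_X // -/c' !zmulA.
rewrite -[X 0 1 a ** _ ** X _ _ c']zmulA mulX_split zmulDr !zmulDl.
rewrite tau2 (h_mul_g _ (erefl : 0 + 2 = 1 + 1 :> int)) !zmulA Xio ?tau_gcoef //.
rewrite -[_ ** g 1 ** gi 1]zmulA ggi zmul1r; congr (_ + _).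
rewrite -[_ ** gi 0 ** X 0 1 _]zmulA gi_X //.
by rewrite (_ : _ / _ * _ = 1) ?zmulA //; field; rewrite d0.
Qed.

Lemma trace_mul_trace a b :
  trace_elt a * trace_elt b = trace_elt (a * b + t0 a * b).
Proof.
rewrite -[LHS]/(io 0 _ ** io 0 _) -ioM ?rmorphD ?tauK 1?addrC //.
by congr (io _ _); rewrite rmorphD !rmorphM tauK; ring.
Qed.

Lemma loop_io a b k : t0 k = k -> loop a b ** io 0 k = loop a (b * k).
Proof.
move=> kE; rewrite /loop -[_ ** gi 0 ** io 0 k]zmulA gi_io // !zmulA.
by rewrite -[_ ** io _ _]zmulA Xio // tau2.
Qed.

Lemma io_loop a b k : t0 k = k -> io 0 k ** loop a b = loop (k * a) b.
Proof. by move=> kE; rewrite /loop !zmulA ioX. Qed.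

Lemma trace_mul_degree1 a b :
  trace_elt a * degree1_elt b = degree1_elt (a * b + t0 a * b).
Proof.
have kE : t0 (a + t0 a) = a + t0 a by rewrite rmorphD tauK addrC.
rewrite {1}/degree1_elt mulrBr mulrnAr trace_mul_trace.
by rewrite -[trace_elt a * (loop b _ : R)]/(io 0 _ ** _) io_loop // mulrDl.
Qed.

Lemma degree1_mul_trace a b :
  degree1_elt a * trace_elt b = degree1_elt (a * t1 (t0 b) + a * t1 b).
Proof.
have kE : t0 (b + t0 b) = b + t0 b by rewrite rmorphD tauK addrC.
rewrite {1}/degree1_elt mulrBl mulrnAl trace_mul_trace.
rewrite -[(loop a _ : R) * trace_elt b]/(_ ** io 0 _) loop_io // loop_degree1.
have d0 := delta_neq0 0.
rewrite -[delta 0 * _ / _]mulrAC divff // mul1r.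
rewrite -[trace_elt (a * b + _)](_ : trace_elt (a * (delta 0 * (b + t0 b)) / delta 0) = _).
  by rewrite addrAC subrr add0r -mulrDr -rmorphD addrC.
rewrite mulrCA mulrAC divff // mul1r mulrDr !raddfD /=; congr (_ + _).
by rewrite -trace_elt_tau rmorphM tauK.
Qed.

Lemma zdiag_laurent : exists Y : int -> F -> R,
  [/\ forall n, {morph Y n : a b / a - b},
      forall n a, Y (- n) a = Y n (t0 a),
      forall (m : nat) n a b, Y m a * Y n b =
        Y (m%:Z + n) (a * spow t0 t1 m b)
        + Y (n - m%:Z) (t0 a * spow t0 t1 (- m%:Z) b),
      Y 0 2^-1 = 1
    & forall P : R -> Prop, P 0 ->
        (forall x y, P x -> P y -> P (x - y)) ->
        (forall (n : nat) a, P (Y n a)) -> forall x, P x].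
Proof.
have [d0 d1] := (delta_neq0 0, delta_neq0 1).
have Y11 := quadratic_relation (tauK 0) (tauK 1) two_neq0 d0 d1 (tau_delta 0)
  (tau_delta 1) trace_eltB degree1_eltB trace_mul_trace trace_mul_degree1
  degree1_mul_trace loop_degree1 loop_mul.
pose Y := lauY t0 t1 trace_elt degree1_elt.
have YM := lauYM (tauK 0) (tauK 1) trace_eltB degree1_eltB trace_elt_tau
  trace_mul_trace trace_mul_degree1 degree1_mul_trace Y11.
have YN n a : Y (- n) a = Y n (t0 a) := lauYN t1 (tauK 0) _ trace_elt_tau n a.
have Y_half : Y 0 2^-1 = 1.
  by rewrite -[LHS]/(trace_elt _) -[_^-1]mul1r -io_trace ?rmorph1 // io1.
exists Y; split=> //; first exact: (lauYB t0 t1 trace_eltB degree1_eltB).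
move=> P P0 PB PY x.
(* The additive span of the [Y n a], as an intersection of subgroups; [GY] gives the stability under
   left multiplication that [generation] asks for. *)
pose G (x : C 0 0) := forall Q : R -> Prop, Q 0 ->
  (forall x y, Q x -> Q y -> Q (x - y)) -> (forall (n : nat) a, Q (Y n a)) -> Q x.
suff Gx : G x by apply: Gx.
have QD (Q : R -> Prop) : Q 0 -> (forall x y, Q x -> Q y -> Q (x - y)) ->
    forall x y, Q x -> Q y -> Q (x + y).
  move=> Q0 QB y z Qy Qz; rewrite -[z]opprK -[- z]add0r.
  by apply: (QB) => //; apply: QB.
have QYint (Q : R -> Prop) : (forall (n : nat) a, Q (Y n a)) -> forall n a, Q (Y n a).
  by move=> QY [n|n] a //; rewrite NegzE YN; apply: QY.
have GY (m : nat) c z : G z -> G ((Y m c : R) * z).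
  move=> Gz Q Q0 QB QY; apply: (Gz (fun z => Q (Y m c * z))) => [|y y' Qy Qy'|n b].
  - by rewrite mulr0.
  - by rewrite mulrBr; apply: QB.
  - by rewrite YM; apply: QD => //; apply: QYint.
have GD z z' : G z -> G z' -> G (z + z').
  by move=> Gz Gz' Q Q0 QB QY; apply: QD => //; [apply: Gz | apply: Gz'].
apply: generation => [Q //|y z Gy Gz Q Q0 QB QY||k z kE Gz|a b z Gz].
- by apply: (QB); [apply: Gy | apply: Gz].
- by move=> Q Q0 QB QY; rewrite -[zone 0]/(1 : R) -Y_half; apply: QY.
- by rewrite io_trace //; apply: (GY 0).
(* [loop_degree1] describes four times a loop, so the first entry is divided by 4. *)
have -> : loop a b = (loop (a / 4) b : R) *+ 4.
  rewrite -(raddfMn (loop_left b)) /loop_left -[a / 4 *+ 4]mulr_natr divfK //.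
  by rewrite (natrM _ 2 2) mulf_neq0.
rewrite loop_degree1 -[_ ** z]/((_ : R) * z) mulrDl.
by apply: GD; [apply: (GY 0) | apply: (GY 1)].
Qed.

End GeneratedZalg.

(** * The presentation of Lambda *)

Lemma zpi_B (C : zalg) (J : zideal C) i j (x y : C i j) :
  zpi J (x - y) = zpi J x - zpi J y.
Proof.
by apply: (addIr (zpi_ J y)); rewrite subrK -[LHS]zpi_D subrK.
Qed.

Lemma zpi_0 (C : zalg) (J : zideal C) i j : zpi J (0 : C i j) = 0.
Proof. by rewrite -[X in zpi J X](subrr 0) zpi_B subrr. Qed.

Section LambdaGenerators.
Variables (F : fieldType) (K0 K1 : divringClosed F) (w : int -> F).
Local Notation K := (Kmod2 K0 K1).
Local Notation T := (tensor_alg K0 K1).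
Local Notation A := (Snc K0 K1 w).
Local Notation Lambda := (localization (g_elt K0 K1 w)).

Definition loc_map i j (a : A i j) : Lambda i j :=
  zpi (zideal_gen (loc_rel (g_elt K0 K1 w))) (lelt a).

Definition gen_gi i : Lambda (i + 2) i :=
  zpi (zideal_gen (loc_rel (g_elt K0 K1 w))) (linv A i).

Lemma loc_eq i j (x y : zlin (lword_cat A) i j) :
  loc_rel (g_elt K0 K1 w) (x - y) ->
  zpi (zideal_gen (loc_rel (g_elt K0 K1 w))) x =
  zpi (zideal_gen (loc_rel (g_elt K0 K1 w))) y.
Proof. by move=> xy; apply/zpi_eqP => J JP; apply: JP. Qed.

Lemma loc_mapD i j (a b : A i j) : loc_map (a + b) = loc_map a + loc_map b.
Proof.
rewrite /loc_map -[RHS]zpi_D; apply: loc_eq; rewrite opprD addrA.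
exact: LocAdd.
Qed.

Lemma loc_mapB i j : {morph @loc_map i j : a b / a - b}.
Proof.
by move=> a b; apply: (addIr (loc_map b)); rewrite -loc_mapD !subrK.
Qed.

Lemma loc_mapM i j l (a : A i j) (b : A j l) :
  loc_map (a ** b) = loc_map a ** loc_map b.
Proof. by rewrite [RHS]zpi_M; apply: loc_eq; apply: LocMul. Qed.

Lemma loc_map1 i : loc_map (zone i) = zone i.
Proof. by apply: loc_eq; apply: LocOne. Qed.

Lemma loc_map_g_gi i : loc_map (g_elt K0 K1 w i) ** gen_gi i = zone i.
Proof. by rewrite [LHS]zpi_M; apply: loc_eq; apply: LocInvr. Qed.

Lemma gen_gi_loc_map i : gen_gi i ** loc_map (g_elt K0 K1 w i) = zone (i + 2).
Proof. by rewrite [LHS]zpi_M; apply: loc_eq; apply: LocInvl. Qed.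

Lemma tensor_eq i j (x y : zlin (tword_cat K0 K1) i j) : tensor_rel (x - y) ->
  zpi (tensor_ideal K0 K1) x = zpi (tensor_ideal K0 K1) y.
Proof. by move=> xy; apply/zpi_eqP; apply: tensor_mem_rel. Qed.

Definition lam i j (t : T i j) : Lambda i j := loc_map (zpi (zideal_gen (h_rel w)) t).

Lemma lamB i j : {morph @lam i j : s t / s - t}.
Proof.
by move=> s t; rewrite /lam zpi_B loc_mapB.
Qed.
HB.instance Definition _ i j :=
  GRing.isZmodMorphism.Build (T i j) (Lambda i j) (@lam i j) (@lamB i j).

Lemma lamM i j l (s : T i j) (t : T j l) : lam (s ** t) = lam s ** lam t.
Proof. by rewrite /lam -loc_mapM [X in _ = loc_map X]zpi_M. Qed.

(* 0 when u is not a word from i to j. *)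
Definition T_word i j (u : F * seq F) : T i j :=
  if insub u is Some u' then zpi (tensor_ideal K0 K1) (@zbasis (tword_cat K0 K1) i j u') else 0.

Lemma T_wordE i j u (uP : tword_pred K0 K1 i j u) : T_word i j u =
  zpi (tensor_ideal K0 K1) (@zbasis (tword_cat K0 K1) i j (Sub u uP)).
Proof. by rewrite /T_word insubT. Qed.

Lemma T_word_mul i j l u v : tword_pred K0 K1 i j u -> tword_pred K0 K1 j l v ->
  T_word i j u ** T_word j l v = T_word i l (tglue u.1 u.2 v).
Proof.
move=> uP vP; have uvP := tglue_subproof (Sub u uP) (Sub v vP).
rewrite !T_wordE [LHS]zpi_M; congr (zpi _ _).
by rewrite [LHS]flin_mulUU; congr << _ >>; apply: val_inj.
Qed.

Lemma T_word_add i j c p q a b :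
    tword_pred K0 K1 i j (c, p ++ a :: q) ->
  T_word i j (c, p ++ (a + b) :: q) =
  T_word i j (c, p ++ a :: q) + T_word i j (c, p ++ b :: q).
Proof.
rewrite /tword_pred /= size_cat /= => uP.
have P x : tword_pred K0 K1 i j (c, p ++ x :: q) by rewrite /tword_pred /= size_cat.
rewrite !(T_wordE (P _)) -[RHS]zpi_D; apply: tensor_eq; rewrite opprD addrA.
exact: (TensorAdd (p := c :: p) (q := q)).
Qed.

Lemma tword_pred_scalar i c : tword_pred K0 K1 i i (c, [::]) = (c \in K i).
Proof. by rewrite /tword_pred /= subrr eqxx andbT. Qed.

Lemma tword_pred1 i j c a :
  tword_pred K0 K1 i j (c, [:: a]) = (c \in K i) && (j == i + 1).
Proof. by rewrite /tword_pred /= [1%:Z == _]eq_sym subr_eq addrC. Qed.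

Definition scal i c : Lambda i i := lam (T_word i i (c, [::])).
Definition gen_x i j a : Lambda i j := lam (T_word i j (1, [:: a])).
Definition gen_g i : Lambda i (i + 2) := loc_map (g_elt K0 K1 w i).

Lemma scalB i a b : a \in K i -> b \in K i -> scal i (a - b) = scal i a - scal i b.
Proof.
move=> aK bK; apply: (addIr (scal i b)); rewrite subrK /scal -raddfD; congr lam.
have P x : x \in K i -> tword_pred K0 K1 i i (x, [::]) by rewrite tword_pred_scalar.
have abK := rpredB aK bK.
rewrite (T_wordE (P _ abK)) (T_wordE (P _ bK)) (T_wordE (P _ aK)) -[LHS]zpi_D.
apply/esym/tensor_eq; rewrite opprD addrA.
apply: (TensorAdd (p := [::]) (q := [::]) (a := a - b) (b := b)) => //=.
by rewrite /tseq /= subrK.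
Qed.

Lemma scal1 i : scal i 1 = zone i.
Proof.
rewrite /scal -loc_map1; congr loc_map; rewrite (T_wordE (tword_id_subproof K0 K1 i)).
by [].
Qed.

Lemma word_mul i j l u v : tword_pred K0 K1 i j u -> tword_pred K0 K1 j l v ->
  lam (T_word i j u) ** lam (T_word j l v) = lam (T_word i l (tglue u.1 u.2 v)).
Proof. by move=> uP vP; rewrite -lamM T_word_mul. Qed.

Lemma scalM i a b : a \in K i -> b \in K i -> scal i (a * b) = scal i a ** scal i b.
Proof. by move=> aK bK; rewrite /scal word_mul ?tword_pred_scalar. Qed.

Lemma gen_x0 i j a : j != i + 1 -> gen_x i j a = 0.
Proof.
by move=> ji; rewrite /gen_x /T_word insubF ?tword_pred1 ?(negPf ji) ?andbF ?raddf0.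
Qed.

Lemma tword_pred_x i a : tword_pred K0 K1 i (i + 1) (1, [:: a]).
Proof. by rewrite tword_pred1 rpred1 eqxx. Qed.

Lemma gen_xB i j : {morph gen_x i j : a b / a - b}.
Proof.
move=> a b; have [->|ji] := eqVneq j (i + 1); last by rewrite !gen_x0 ?subr0.
apply: (addIr (gen_x i (i + 1) b)); rewrite subrK /gen_x -raddfD /=.
by have /= <- := T_word_add (p := [::]) b (tword_pred_x i (a - b)); rewrite subrK.
Qed.

Lemma scal_gen_x i j k a : k \in K i -> scal i k ** gen_x i j a = gen_x i j (k * a).
Proof.
move=> kK; have [->|ji] := eqVneq j (i + 1); last by rewrite !gen_x0 ?zmul0r.
rewrite /scal /gen_x word_mul ?tword_pred_scalar ?tword_pred_x //= mulr1.
have kP : tword_pred K0 K1 i (i + 1) (k, [:: a]) by rewrite tword_pred1 kK eqxx.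
rewrite (T_wordE kP) (T_wordE (tword_pred_x i (k * a))); congr lam; apply: tensor_eq.
by apply: (TensorBal (p := [::]) (q := [::]) (a := 1) (k := k)); rewrite /= ?addr0 ?mul1r.
Qed.

Lemma gen_x_scal i j a k : k \in K j -> gen_x i j a ** scal j k = gen_x i j (a * k).
Proof.
move=> kK; have [ji|ji] := eqVneq j (i + 1); last by rewrite !gen_x0 ?zmul0l.
by subst j; rewrite /scal /gen_x word_mul ?tword_pred_scalar ?tword_pred_x.
Qed.

Lemma gen_x_mul i j a b : j = i + 1 -> gen_x i j a ** gen_x j (i + 2) b = lam (tens2 K0 K1 i a b).
Proof.
move=> ->; rewrite /gen_x word_mul ?tword_pred_x //=; last first.
  by rewrite -[i + 2]/(i + (1 + 1)) addrA tword_pred_x.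
by rewrite mulr1 (T_wordE (tens2_subproof K0 K1 i a b)).
Qed.

Lemma h_relation i j : j = i + 1 ->
  gen_x i j 1 ** gen_x j (i + 2) 1 + gen_x i j (w j)^-1 ** gen_x j (i + 2) (w j) = 0.
Proof.
move=> jE; rewrite !gen_x_mul // jE -raddfD /= /lam -[RHS](raddf0 (@lam i (i + 2))).
congr loc_map; apply/zpi_eqP => J JP; rewrite subr0; apply: JP; exact: HRel.
Qed.

Lemma g_relation i j : w j != 0 -> j = i + 1 ->
  gen_g i = gen_x i j (w j) ** gen_x j (i + 2) 1 + gen_x i j 1 ** gen_x j (i + 2) (w j).
Proof.
move=> w0 jE; rewrite !gen_x_mul // -raddfD /lam; subst j.
by rewrite /gen_g /g_elt divff.
Qed.

(** The elements whose left multiplication preserves P are closed under differences and products and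
    contain the generators, hence are everything; they are then applied to the unit at 0. *)
Lemma Lambda_ind (P : forall i, Lambda i 0 -> Prop) :
  (forall i, P i 0) -> (forall i x y, P i x -> P i y -> P i (x - y)) ->
  P 0 (zone 0) ->
  (forall i k x, k \in K i -> P i x -> P i (scal i k ** x)) ->
  (forall i j a x, j = i + 1 -> P j x -> P i (gen_x i j a ** x)) ->
  (forall i x, P i x -> P (i + 2) (gen_gi i ** x)) -> forall i x, P i x.
Proof.
move=> P0 PB P1 Pio PX Pgi.
pose S i l (z : Lambda i l) := forall c, P l c -> P i (z ** c).
suff Sall i l z : S i l z by move=> i x; rewrite -[x]zmul1r; apply: Sall.
have S0 i' l' : S i' l' 0 by move=> c _; rewrite zmul0l.
have SB i' l' (x y : Lambda i' l') : S i' l' x -> S i' l' y -> S i' l' (x - y).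
  by move=> Sx Sy c Pc; rewrite zmulBl; apply: PB; [apply: Sx | apply: Sy].
have SM i' j' l' (x : Lambda i' j') (y : Lambda j' l') :
    S i' j' x -> S j' l' y -> S i' l' (x ** y).
  by move=> Sx Sy c Pc; rewrite -zmulA; apply/Sx/Sy.
have Sword i' j' (u : tword K0 K1 i' j') : S i' j' (lam (T_word i' j' (val u))).
  case: u => [[c s]] /= uP; elim: s i' c uP => [|a s IH] i' c uP.
    have := uP; rewrite /tword_pred /= => /andP[cK]; rewrite eq_sym subr_eq0 => /eqP e.
    by subst j'; move=> x Px; apply: Pio.
  have := uP; rewrite /tword_pred /= => /andP[cK /eqP se].
  have sP : tword_pred K0 K1 (i' + 1) j' (1, s).
    by rewrite /tword_pred /= rpred1; apply/eqP; lia.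
  have -> : lam (T_word i' j' (c, a :: s)) =
      scal i' c ** gen_x i' (i' + 1) a ** lam (T_word (i' + 1) j' (1, s)).
    rewrite /scal /gen_x !word_mul ?tword_pred_scalar ?tword_pred_x //=.
      by rewrite !mulr1.
    by rewrite mulr1 tword_pred1 cK eqxx.
  apply: (SM _ (i' + 1)); last exact: IH.
  by apply: SM => y Py; [apply: Pio | apply: PX].
have SA i' j' (a : A i' j') : S i' j' (loc_map a).
  have [t ->] := zpi_surj a; have [D ->] := zpi_surj t.
  elim/freeg_ind_span: D => [|D E hD hE|u].
  - by rewrite -[X in S _ _ X]/(lam (zpi (tensor_ideal K0 K1) 0)) zpi_0 raddf0.
  - rewrite -[X in S _ _ X]/(lam (zpi (tensor_ideal K0 K1) _)) zpi_B raddfB.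
    exact: SB.
  - case: u => u uP; have := Sword i' j' (Sub u uP : tword K0 K1 i' j').
    by rewrite SubK (T_wordE uP).
have [D ->] := zpi_surj z.
elim/freeg_ind_span: D => [|D E hD hE|u].
- by rewrite -[X in S _ _ X]/(zpi (zideal_gen (loc_rel (g_elt K0 K1 w))) 0) zpi_0.
- rewrite -[X in S _ _ X]/(zpi (zideal_gen (loc_rel (g_elt K0 K1 w))) _) zpi_B.
  exact: SB.
elim: u => [i'|i' j' l' a u IH|i' l' u IH].
- by move=> c Pc; rewrite zmul1l.
- have -> : zpi_ (zideal_gen (loc_rel (g_elt K0 K1 w))) << LElt a u >> =
      loc_map a ** zpi_ (zideal_gen (loc_rel (g_elt K0 K1 w))) << u >>.
    by rewrite [RHS]zpi_M; congr zpi_; apply/esym/flin_mulUU.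
  by apply: SM.
have -> : zpi_ (zideal_gen (loc_rel (g_elt K0 K1 w))) << LInv u >> =
    gen_gi i' ** zpi_ (zideal_gen (loc_rel (g_elt K0 K1 w))) << u >>.
  by rewrite [RHS]zpi_M; congr zpi_; apply/esym/flin_mulUU.
by apply: SM => // c Pc; apply: Pgi.
Qed.

End LambdaGenerators.

(** * A nonzero action of Lambda *)

Section LinearisedAction.
Variables (W : zcat) (U : zmodType) (act : forall i j, W i j -> U -> U).
Hypothesis actB : forall i j (u : W i j), {morph act u : x y / x - y}.
Hypothesis act_comp : forall i j l (u : W i j) (v : W j l) y,
  act (zcomp u v) y = act u (act v y).

Definition lin_act i j (D : zlin W i j) y : U := flift (fun u => act u y) D.

Lemma lin_actU i j (u : W i j) y : lin_act (zbasis u) y = act u y.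
Proof. exact: fliftU. Qed.

Lemma lin_actBl i j (D E : zlin W i j) y : lin_act (D - E) y = lin_act D y - lin_act E y.
Proof. exact: fliftB. Qed.

Lemma lin_act0l i j y : lin_act (0 : zlin W i j) y = 0.
Proof. exact: (raddf0 (flift _)). Qed.

Lemma lin_actBr i j (D : zlin W i j) : {morph lin_act D : x y / x - y}.
Proof.
move=> x y; rewrite /lin_act /flift -sumrB; apply: eq_bigr => u _.
by rewrite -mulrzBl actB.
Qed.

Lemma lin_act0r i j (D : zlin W i j) : lin_act D 0 = 0.
Proof. by rewrite -[in LHS](subrr 0) lin_actBr subrr. Qed.

Lemma lin_actM i j l (D : zlin W i j) (E : zlin W j l) y :
  lin_act (D ** E) y = lin_act D (lin_act E y).
Proof.
elim/freeg_ind_span: D => [|D D' hD hD'|u]; first by rewrite zmul0l !lin_act0l.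
  by rewrite zmulBl !lin_actBl hD hD'.
elim/freeg_ind_span: E => [|E E' hE hE'|v].
- by rewrite zmul0r !lin_act0l lin_act0r.
- by rewrite zmulBr !lin_actBl lin_actBr hE hE'.
by rewrite -[_ ** _]/(flin_mul _ _) flin_mulUU !lin_actU act_comp.
Qed.

Lemma lin_act_stable (V : int -> U -> Prop) :
  (forall i, V i 0) -> (forall i x y, V i x -> V i y -> V i (x - y)) ->
  (forall i j (u : W i j) y, V j y -> V i (act u y)) ->
  forall i j (D : zlin W i j) y, V j y -> V i (lin_act D y).
Proof.
move=> V0 VB VM i j D y Vy; elim/freeg_ind_span: D => [|D E hD hE|u].
- by rewrite lin_act0l.
- by rewrite lin_actBl; apply: VB.
- by rewrite lin_actU; apply: VM.
Qed.

End LinearisedAction.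

Section LambdaRepresentation.
Variables (F : fieldType) (K0 K1 : divringClosed F) (w : int -> F).
Variable tau : int -> {rmorphism F -> F}.
Hypothesis two_neq0 : 2%:R != 0 :> F.
Hypothesis tauK : forall i, involutive (tau i).
Hypothesis tau2 : forall i, tau (i + 2) = tau i.
Hypothesis tau_fix : forall i k, k \in Kmod2 K0 K1 i -> tau i k = k.
Hypothesis tauw : forall i, tau i (w i) = - w i.
Hypothesis w_neq0 : forall i, w i != 0.
Hypothesis w_moved : forall i, tau i (w (i + 1)) != w (i + 1).
Local Notation K := (Kmod2 K0 K1).
Local Notation T := (tensor_alg K0 K1).
Local Notation A := (Snc K0 K1 w).
Local Notation Lambda := (localization (g_elt K0 K1 w)).
Local Notation delta := (delta tau w).

Definition sgz2 (i : int) : F := if odd `|(i %/ 2)%Z|%N then -1 else 1.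

Lemma sgz2D i : sgz2 (i + 2) = - sgz2 i.
Proof.
rewrite /sgz2; have -> : ((i + 2) %/ 2)%Z = (i %/ 2)%Z + 1 by lia.
move: (i %/ 2)%Z => m; have -> : odd (absz (m + 1)) = ~~ odd (absz m) by lia.
by case: odd => //=; rewrite opprK.
Qed.

Lemma sgz2_sq i : sgz2 i * sgz2 i = 1.
Proof. by rewrite /sgz2; case: ifP; rewrite ?mulrNN mulr1. Qed.

Lemma tau_sgz2 j i : tau j (sgz2 i) = sgz2 i.
Proof. by rewrite /sgz2; case: ifP; rewrite ?rmorphN rmorph1. Qed.

(* Object i acts on the space eigen i of eigenvectors of tau_i whose eigenvalue
   sgz2 i = 1, 1, -1, -1, ... changes between i and i + 2: this is what makes
   h_i act as zero and g_i as multiplication by delta i. *)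
Definition eigen i y := tau i y = sgz2 i * y.
Definition proj i y := (y + sgz2 i * tau i y) / 2.

Lemma eigen0 i : eigen i 0. Proof. by rewrite /eigen rmorph0 mulr0. Qed.

Lemma eigenB i x y : eigen i x -> eigen i y -> eigen i (x - y).
Proof. by rewrite /eigen rmorphB mulrBr => -> ->. Qed.

Lemma eigen_proj i y : eigen i (proj i y).
Proof.
rewrite /eigen /proj fmorph_div rmorphD rmorphM tauK tau_sgz2 rmorph_nat mulrA.
by congr (_ / _); rewrite mulrDr mulrA sgz2_sq mul1r addrC.
Qed.

Lemma eigen_scale i k y : tau i k = k -> eigen i y -> eigen i (k * y).
Proof. by rewrite /eigen rmorphM => -> ->; rewrite mulrCA. Qed.

Lemma projB i : {morph proj i : x y / x - y}.
Proof. by move=> x y; rewrite /proj -mulrBl rmorphB mulrBr opprD addrACA. Qed.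

Lemma projD i : {morph proj i : x y / x + y}.
Proof. by move=> x y; rewrite /proj -mulrDl rmorphD mulrDr addrACA. Qed.

Lemma proj_scale i k y : tau i k = k -> proj i (k * y) = k * proj i y.
Proof. by move=> kE; rewrite /proj rmorphM kE mulrCA -mulrDr mulrA. Qed.

(** With p_i for [proj i], the tensor of x_0, ..., x_m sends y to x_0 p_i(x_1 p_{i+1}(... x_m y)).
    Linearity of p_i over K_i gives balancing; the absence of a projection after the last slot makes
    gluing of words a composition. *)
Fixpoint tens_act (i : int) (l : seq F) (y : F) : F :=
  if l is c :: s then
    c * (if s is [::] then y else proj i (tens_act (i + 1) s y))
  else y.

Lemma tens_act_cons i c p a q y : tens_act i (c :: p ++ a :: q) y =
  c * proj i (tens_act (i + 1) (p ++ a :: q) y).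
Proof. by case: p. Qed.

Lemma tens_actB i l : {morph tens_act i l : x y / x - y}.
Proof.
move=> x y; elim: l i => [|c [|a s] IH] i //=; first by rewrite mulrBr.
by rewrite -mulrBr -projB -IH.
Qed.

Lemma tens_actD i p a b q y : tens_act i (p ++ (a + b) :: q) y =
  tens_act i (p ++ a :: q) y + tens_act i (p ++ b :: q) y.
Proof.
elim: p i => [|c p IH] i; first by rewrite /= mulrDl.
by rewrite !cat_cons !tens_act_cons IH projD mulrDr.
Qed.

Lemma tens_act_bal i p a k b q y : k \in K (i + (size p)%:Z) ->
  tens_act i (p ++ a * k :: b :: q) y = tens_act i (p ++ a :: k * b :: q) y.
Proof.
elim: p i => [|c p IH] i kK.
  rewrite /= addr0 in kK *; have kE := tau_fix kK.
  by rewrite -[k * b * _]mulrA (proj_scale _ kE) mulrA.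
rewrite !cat_cons !tens_act_cons IH //.
by move: kK; rewrite /= -addrA.
Qed.

Lemma tens_act_cat i j c s a t y : j = i + (size s)%:Z ->
  tens_act i (belast c s ++ last c s * a :: t) y =
  tens_act i (c :: s) (tens_act j (a :: t) y).
Proof.
elim: s i c => [|b s IH] i c jE /=.
  by rewrite -mulrA jE addr0.
rewrite (IH (i + 1)) //; last by rewrite jE /= intS addrA.
by case E: (belast b s ++ _) => [|z l]; first by case: (belast b s) E.
Qed.

Lemma tens_act_stable i j c s y : j = i + (size s)%:Z -> tau i c = c ->
  eigen j y -> eigen i (tens_act i (c :: s) y).
Proof.
move=> jE cE Vy; case: s jE => [|b s] jE; apply: eigen_scale => //.
  by rewrite jE addr0 in Vy.
exact: eigen_proj.
Qed.

Definition word_act i j (u : tword_cat K0 K1 i j) y := tens_act i (tseq u) y.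

Lemma word_actB i j (u : tword_cat K0 K1 i j) : {morph word_act u : x y / x - y}.
Proof. exact: tens_actB. Qed.

Lemma tword_size i j (u : tword K0 K1 i j) : j = i + (size (val u).2)%:Z.
Proof. by have /andP[_ /eqP ->] := valP u; rewrite addrC subrK. Qed.

Lemma word_act_comp i j l (u : tword_cat K0 K1 i j) (v : tword_cat K0 K1 j l) y :
  word_act (zcomp u v) y = word_act u (word_act v y).
Proof.
rewrite /word_act tseq_comp (tens_act_cat _ _ _ _ (tword_size u)).
by [].
Qed.

Lemma word_act_stable i j (u : tword_cat K0 K1 i j) y : eigen j y -> eigen i (word_act u y).
Proof.
apply: tens_act_stable; first exact: tword_size.
by have /andP[/tau_fix] := valP u.
Qed.

Lemma tensor_act0 i j (D : zlin (tword_cat K0 K1) i j) y :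
  tensor_mem D -> lin_act word_act D y = 0.
Proof.
move=> DP; apply: (DP (fun D => lin_act word_act D y = 0)).
- exact: lin_act0l.
- by move=> D1 D2 h1 h2; rewrite lin_actBl h1 h2 subrr.
move=> _ [p q a b u v x eu ev ex|p q a k b u v kK eu ev].
  rewrite !lin_actBl !lin_actU /word_act eu ev ex tens_actD.
  by rewrite -addrA -opprD subrr.
by rewrite lin_actBl !lin_actU /word_act eu ev tens_act_bal ?subrr.
Qed.

Definition T_act i j (t : T i j) y := lin_act word_act (repr t) y.

Lemma T_actE i j (D : zlin (tword_cat K0 K1) i j) y :
  T_act (zpi (tensor_ideal K0 K1) D) y = lin_act word_act D y.
Proof.
apply/eqP; rewrite -subr_eq0 -lin_actBl; apply/eqP/tensor_act0.
by apply/(zpi_eqP (tensor_ideal K0 K1)); rewrite /zpi_ reprK.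
Qed.

Lemma T_actBr i j (t : T i j) : {morph T_act t : x y / x - y}.
Proof. exact: (lin_actBr word_actB). Qed.

Lemma T_actBl i j (s t : T i j) y : T_act (s - t) y = T_act s y - T_act t y.
Proof.
have [D ->] := zpi_surj s; have [E ->] := zpi_surj t.
by rewrite -zpi_B !T_actE lin_actBl.
Qed.

Lemma T_actM i j l (s : T i j) (t : T j l) y : T_act (s ** t) y = T_act s (T_act t y).
Proof.
have [D ->] := zpi_surj s; have [E ->] := zpi_surj t.
by rewrite [_ ** _]zpi_M !T_actE (lin_actM word_actB word_act_comp).
Qed.

Lemma T_act_stable i j (t : T i j) y : eigen j y -> eigen i (T_act t y).
Proof. by apply: lin_act_stable; [exact: eigen0 | exact: eigenB | exact: word_act_stable]. Qed.

Lemma T_act0r i j (t : T i j) : T_act t 0 = 0.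
Proof. exact: (lin_act0r word_actB). Qed.

(** Restricting to eigenvectors lets the h_i belong to it; it remains two-sided because T_ij maps
    [eigen j] into [eigen i]. *)
Definition T_annihilator : zideal T.
Proof.
refine (@ZIdeal T (fun i j t => forall y, eigen j y -> T_act t y = 0) _ _ _ _).
- by move=> i j y _; rewrite -[X in T_act X](subrr 0) T_actBl subrr.
- by move=> i j s t hs ht y Vy; rewrite T_actBl hs // ht // subrr.
- by move=> i j l a t ht y Vy; rewrite T_actM ht // T_act0r.
- by move=> i j l t a ht y Vy; rewrite T_actM ht //; apply: T_act_stable.
Defined.

Lemma T_actDl i j (s t : T i j) y : T_act (s + t) y = T_act s y + T_act t y.
Proof.
by apply/eqP; rewrite -subr_eq -T_actBl addrK.
Qed.

Lemma T_act_tens2 i a b y : T_act (tens2 K0 K1 i a b) y =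
  proj i (a * proj (i + 1) (b * y)).
Proof. by rewrite T_actE lin_actU /word_act /= mul1r. Qed.

Lemma eigen_add2 i y : eigen (i + 2) y -> tau i y = - (sgz2 i * y).
Proof. by rewrite /eigen tau2 sgz2D mulNr. Qed.

(** With w = w_{i+1}, p_{i+1}(y) + w^-1 p_{i+1}(w y) = y, since w exchanges the two eigenspaces of
    tau_{i+1}. Then p_i(y) = 0, as y has the opposite eigenvalue for tau_i. *)
Lemma T_act_h i y : eigen (i + 2) y -> T_act (h_elt K0 K1 w i) y = 0.
Proof.
move=> Vy; have w0 := w_neq0 (i + 1).
rewrite T_actDl !T_act_tens2 -projD {1}/proj /proj.
have -> : 1 * ((1 * y + sgz2 (i + 1) * tau (i + 1) (1 * y)) / 2) +
    (w (i + 1))^-1 * ((w (i + 1) * y + sgz2 (i + 1) * tau (i + 1) (w (i + 1) * y)) / 2) = y.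
  by rewrite !rmorphM rmorph1 tauw; field; rewrite w0 two_neq0.
by rewrite (eigen_add2 Vy) mulrN mulrA sgz2_sq mul1r subrr mul0r.
Qed.

Definition A_act i j (a : A i j) y := T_act (repr a) y.

Lemma A_actE i j (t : T i j) y : eigen j y ->
  A_act (zpi (zideal_gen (h_rel w)) t) y = T_act t y.
Proof.
move=> Vy; apply/eqP; rewrite -subr_eq0 -T_actBl; apply/eqP.
have : zpi_ (zideal_gen (h_rel (K0 := K0) (K1 := K1) w))
    (repr (zpi (zideal_gen (h_rel (K0 := K0) (K1 := K1) w)) t)) = zpi_ _ t.
  by rewrite /zpi_ reprK.
move/zpi_eqP => /(_ T_annihilator) h; apply: h => //.
by move=> _ _ _ [k] z Vz; apply: T_act_h.
Qed.

Lemma A_actBr i j (a : A i j) : {morph A_act a : x y / x - y}.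
Proof. exact: T_actBr. Qed.

Lemma A_act_stable i j (a : A i j) y : eigen j y -> eigen i (A_act a y).
Proof. exact: T_act_stable. Qed.

Lemma A_actDl i j (a b : A i j) y : eigen j y -> A_act (a + b) y = A_act a y + A_act b y.
Proof.
move=> Vy; have [s ->] := zpi_surj a; have [t ->] := zpi_surj b.
by rewrite -[_ + _]zpi_D !A_actE // T_actDl.
Qed.

Lemma A_actM i j l (a : A i j) (b : A j l) y : eigen l y ->
  A_act (a ** b) y = A_act a (A_act b y).
Proof.
move=> Vy; have [s ->] := zpi_surj a; have [t ->] := zpi_surj b.
by rewrite [_ ** _]zpi_M !A_actE ?T_actM //; apply: T_act_stable.
Qed.

Lemma T_act1 i y : T_act (zone i) y = y.
Proof. by rewrite T_actE lin_actU /word_act /= mul1r. Qed.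

Lemma A_act1 i y : eigen i y -> A_act (zone i) y = y.
Proof. by move=> Vy; rewrite A_actE // T_act1. Qed.

(** The same averaging leaves p_i(w_{i+1} y); as tau_i acts on y with the opposite sign, this picks
    out the antisymmetric part of w_{i+1}. *)
Lemma A_act_g i y : eigen (i + 2) y -> A_act (g_elt K0 K1 w i) y = delta i * y.
Proof.
move=> Vy; have w0 := w_neq0 (i + 1).
rewrite A_actE // T_actDl !T_act_tens2 -projD {1}/proj /proj divff //.
have -> : w (i + 1) * ((1 * y + sgz2 (i + 1) * tau (i + 1) (1 * y)) / 2) +
    1 * ((w (i + 1) * y + sgz2 (i + 1) * tau (i + 1) (w (i + 1) * y)) / 2)
    = w (i + 1) * y.
  by rewrite !rmorphM rmorph1 tauw; field.
rewrite rmorphM (eigen_add2 Vy) !mulrN [sgz2 i * (tau i _ * _)]mulrCA.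
rewrite [sgz2 i * (sgz2 i * y)]mulrA sgz2_sq mul1r.
by rewrite /delta; field.
Qed.

Lemma eigen_delta i y : eigen i y -> eigen (i + 2) (y / delta i).
Proof.
rewrite /eigen tau2 sgz2D fmorph_div (tau_delta w tauK) => ->.
by rewrite invrN mulrN mulNr mulrA.
Qed.

Fixpoint lword_act i j (u : lword A i j) : F -> F :=
  match u with
  | LNil _ => fun y => y
  | LElt _ _ _ a u' => fun y => A_act a (lword_act u' y)
  | LInv i _ u' => fun y => lword_act u' y / delta i
  end.

Definition loc_word_act i j (u : lword_cat A i j) := lword_act u.

Lemma lword_actB i j (u : lword_cat A i j) : {morph loc_word_act u : x y / x - y}.
Proof.
move=> x y; elim: u => //= [i' j' l' a u ->|i' l' u ->]; first exact: A_actBr.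
by rewrite mulrBl.
Qed.

Lemma lword_act_comp i j l (u : lword_cat A i j) (v : lword_cat A j l) y :
  loc_word_act (zcomp u v) y = loc_word_act u (loc_word_act v y).
Proof. by elim: u v => //= [i' j' l' a u IH|i' l' u IH] v; rewrite IH. Qed.

Lemma lword_act_stable i j (u : lword_cat A i j) y : eigen j y -> eigen i (loc_word_act u y).
Proof.
elim: u => //= [i' j' l' a u IH|i' l' u IH] Vy; first by apply/A_act_stable/IH.
by apply/eigen_delta/IH.
Qed.

Definition loc_annihilator : zideal (zlin (lword_cat A)).
Proof.
refine (@ZIdeal _ (fun i j (D : zlin (lword_cat A) i j) =>
  forall y, eigen j y -> lin_act loc_word_act D y = 0) _ _ _ _).
- by move=> i j y _; apply: lin_act0l.
- by move=> i j D E hD hE y Vy; rewrite lin_actBl hD // hE // subrr.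
- move=> i j l a D hD y Vy; rewrite (lin_actM lword_actB lword_act_comp) hD //.
  exact: (lin_act0r lword_actB).
- move=> i j l D a hD y Vy; rewrite (lin_actM lword_actB lword_act_comp) hD //.
  apply: (lin_act_stable (V := eigen)) => //; [exact: eigen0|exact: eigenB|exact: lword_act_stable].
Defined.

Lemma loc_rel_annihilated i j (D : zlin (lword_cat A) i j) :
  loc_rel (g_elt K0 K1 w) D -> loc_annihilator i j D.
Proof.
have act_elt i' j' (a : A i' j') y : lin_act loc_word_act (lelt a) y = A_act a y.
  by rewrite lin_actU.
have act_inv i' y : lin_act loc_word_act (linv A i') y = y / delta i'.
  by rewrite lin_actU.
have act1 i' y : lin_act loc_word_act (zone i' : zlin (lword_cat A) i' i') y = y.
  by rewrite lin_actU.
have actM := lin_actM lword_actB lword_act_comp.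
case=> [i' j' a b|i' j' l' a b|i'|i'|i'] y Vy;
  rewrite !lin_actBl ?actM ?act_elt ?act_inv ?act1 ?act_elt ?act_inv.
- by rewrite A_actDl // -addrA -opprD subrr.
- by rewrite A_actM // subrr.
- by rewrite A_act1 // subrr.
- rewrite A_act_g; last exact: eigen_delta.
  by rewrite mulrC divfK ?subrr // delta_neq0.
- by rewrite A_act_g // mulrAC divff ?mul1r ?subrr // delta_neq0.
Qed.

(** The unit acts as the identity on [eigen 0], which contains 1. *)
Lemma Lambda_nontrivial : (zone 0 : Lambda 0 0) <> 0.
Proof.
pose J := zideal_gen (loc_rel (g_elt K0 K1 w)).
move=> z0; have : zpi_ J (zone 0) = zpi_ J 0 by rewrite -[RHS]/(zpi J 0) zpi_0.
move=> /zpi_eqP /(_ loc_annihilator loc_rel_annihilated 1).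
rewrite subr0 lin_actU /= => h; have := h _.
rewrite /eigen rmorph1 /sgz2 /= mulr1 => /(_ erefl) /eqP.
by rewrite oner_eq0.
Qed.

End LambdaRepresentation.

(** * Finite order and algebraicity *)

Section IndexTwo.
Variables (F : fieldType) (K : divringClosed F) (tau : {rmorphism F -> F}).
Hypothesis indexK : subfield_index K predT 2.
Hypothesis galK : galois_involution K tau.

(** Cramer's rule: the determinant D of the coordinates of 1 and x vanishes only if x is a
    K-multiple of 1. *)
Lemma index2_span x : x \notin K -> forall y, exists p q,
  [/\ p \in K, q \in K & y = p + q * x].
Proof.
case: indexK => b [_ bP] xK y.
have coord z : exists c0 c1, [/\ c0 \in K, c1 \in K & z = c0 * b 0 + c1 * b 1].
  have [c [[cK ->] _]] := bP z isT; exists (c 0), (c 1); split=> //.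
  by rewrite big_ord_recl big_ord1; congr (_ + c _ * b _); apply: val_inj.
have [c0 [c1 [c0K c1K cE]]] := coord 1; have [d0 [d1 [d0K d1K dE]]] := coord x.
have [y0 [y1 [y0K y1K yE]]] := coord y.
pose D := c0 * d1 - c1 * d0.
have D0 : D != 0.
  apply/eqP => /eqP; rewrite subr_eq0 => /eqP De; case/negP: xK.
  have [c00|c00] := eqVneq c0 0.
    have c10 : c1 != 0.
      by apply: contra_eq_neq cE => ->; rewrite c00 !mul0r addr0 oner_eq0.
    have d00 : d0 = 0.
      by move/eqP: De; rewrite c00 mul0r eq_sym mulf_eq0 (negPf c10) => /eqP.
    rewrite (_ : x = d1 / c1); first exact: rpred_div.
    rewrite dE d00 mul0r add0r -[d1 / c1]mulr1 cE c00; field; exact: c10.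
  rewrite (_ : x = d0 / c0); first exact: rpred_div.
  have d1E : d1 = c1 * d0 / c0 by rewrite -De mulrAC divff ?mul1r.
  rewrite dE d1E -[d0 / c0]mulr1 cE; field; exact: c00.
exists ((y0 * d1 - y1 * d0) / D), ((y1 * c0 - y0 * c1) / D); split.
- by rewrite rpred_div ?rpredB ?rpredM.
- by rewrite rpred_div ?rpredB ?rpredM.
have b0 : b 0 = (d1 * 1 - c1 * x) / D by rewrite cE dE /D; field.
have b1 : b 1 = (c0 * x - d0 * 1) / D by rewrite cE dE /D; field.
by rewrite yE b0 b1; field.
Qed.

Lemma galois_fixes k : k \in K -> tau k = k.
Proof. by case: galK => bij _ /(_ tau bij) [_ h]; apply: h; right. Qed.

Lemma galoisK : involutive tau.
Proof.
case: galK => bij nid galP x.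
have [|h|h] := (galP (tau \o tau) (bij_comp bij bij)).1.
- by move=> k kK; rewrite /= !galois_fixes.
- exact: h.
by case: nid => z; have := h z; move/(bij_inj bij).
Qed.

(** A fixed element outside K would span F over K together with 1, and tau would be the identity. *)
Lemma galois_fixedE k : (k \in K) = (tau k == k).
Proof.
apply/idP/eqP => [/galois_fixes //|kE]; apply: contraT => kK.
case: galK => _ nid _; case: nid => y; have [p [q [pK qK ->]]] := index2_span kK y.
by rewrite rmorphD rmorphM kE !galois_fixes.
Qed.

End IndexTwo.

(** Dedekind's argument: the relation at y x minus f_n(y) times the relation at x is shorter, and y
    is chosen with f_i(y) and f_n(y) distinct. *)
Lemma characters_independent (F : fieldType) (n : nat) (f : nat -> F -> F) (c : nat -> F) :
    (forall i, f i 1 = 1) -> (forall i x y, f i (x * y) = f i x * f i y) ->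
    (forall i j, (i < j < n)%N -> exists x, f i x != f j x) ->
    (forall x, \sum_(i < n) c i * f i x = 0) ->
  forall i, (i < n)%N -> c i = 0.
Proof.
move=> f1 fM; elim: n c => // n IH c fP c0.
have c0n i : (i < n)%N -> c i = 0.
  move=> lin; have [|y fy] := fP i n; first by rewrite lin ltnSn.
  suff /eqP : c i * (f i y - f n y) = 0.
    by rewrite mulf_eq0 subr_eq0 (negPf fy) orbF => /eqP.
  apply: (IH (fun i => c i * (f i y - f n y))) lin.
    by move=> i' j' /andP[ij jn]; apply: fP; rewrite ij ltnW.
  move=> x; have := c0 (y * x); have /(congr1 ( *%R (f n y))) := c0 x.
  rewrite mulr0 !big_ord_recr /= mulrDr mulr_sumr => e1 e2.
  have := congr2 (fun a b => a - b) e2 e1; rewrite subrr fM.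
  rewrite [f n y * (c n * _)]mulrCA => e3; rewrite -[RHS]e3.
  rewrite opprD addrACA subrr addr0 -sumrB. apply: eq_bigr => j _.
  by rewrite fM; ring.
move=> i; rewrite ltnS leq_eqVlt => /predU1P[->|]; last exact: c0n.
have := c0 1; rewrite big_ord_recr /= f1 mulr1 big1 ?add0r // => j _.
by rewrite c0n ?mul0r.
Qed.

(** An independent family in E is extended until it spans. By [dep] its length stays below B; d
    counts the extensions still possible. *)
Lemma exists_basis (F : fieldType) (k : divringClosed F) (E : {pred F}) (B : nat) :
    (forall a : 'I_B -> F, exists2 u : 'I_B -> F,
       (forall t, u t \in k) /\ (exists t, u t != 0) & \sum_t u t * a t = 0) ->
  exists n, subfield_index k E n.
Proof.
move=> dep.
pose indep n (b : 'I_n -> F) := forall c : 'I_n -> F, (forall t, c t \in k) ->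
  \sum_t c t * b t = 0 -> forall t, c t = 0.
suff ext d n (b : 'I_n -> F) : (n + d)%N = B -> (forall t, b t \in E) -> indep n b ->
    exists n, subfield_index k E n.
  by apply: (ext B 0 (fun=> 0)) => [|[]|c _ _ []].
elim: d n b => [|d IH] n b nd bE bI.
  move: b bE bI; rewrite addn0 in nd; subst n => b bE bI.
  by have [u [uk [t /eqP ut]] u0] := dep b; case: ut; apply: bI.
have [span|] := pselect (forall x, x \in E -> exists c : 'I_n -> F,
    (forall t, c t \in k) /\ x = \sum_t c t * b t).
  exists n, b; split=> // x xE; have [c [ck xc]] := span x xE.
  exists (finfun c); split.
    by split=> [t|]; rewrite ?ffunE // xc; apply: eq_bigr => t _; rewrite ffunE.
  move=> c' [c'k xc']; apply/ffunP => t; rewrite ffunE; apply/eqP.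
  rewrite -subr_eq0; apply/eqP; apply: (bI (fun t => c t - c' t)) => [t'|].
    exact: rpredB.
  by under eq_bigr do rewrite mulrBl; rewrite sumrB -xc -xc' subrr.
move=> /existsNP [x /not_implyP [xE xspan]].
pose b' (t : 'I_n.+1) := if unlift ord_max t is Some t' then b t' else x.
apply: (IH n.+1 b') => [|t|c ck]; first by rewrite addSnnS.
  by rewrite /b'; case: unliftP.
have wE (t : 'I_n) : widen_ord (leqnSn n) t = fintype.lift ord_max t.
  exact/val_inj/esym/lift_max.
rewrite big_ord_recr /= {2}/b' unlift_none.
under eq_bigr => t _ do rewrite wE /b' liftK.
move=> e; have cmax : c ord_max = 0.
  apply/eqP/contraT => cx; case: xspan.
  exists (fun t => - c (fintype.lift ord_max t) / c ord_max); split=> [t|].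
    by rewrite rpred_div ?rpredN.
  apply: (mulfI cx); rewrite mulr_sumr.
  under eq_bigr => t _ do rewrite mulrA mulrCA divff // mulr1 mulNr.
  by rewrite sumrN; apply/eqP; rewrite -addr_eq0 addrC e.
rewrite cmax mul0r addr0 in e; move=> t.
case: (unliftP ord_max t) => [t' ->|-> //].
exact: (bI (fun t => c (fintype.lift ord_max t))).
Qed.

Section FiniteOrderAlgebraic.
Variables (F : fieldType) (K0 K1 : divringClosed F) (t0 t1 : {rmorphism F -> F}).
Hypotheses (t0K : involutive t0) (t1K : involutive t1).
Hypotheses (K0E : forall x, (x \in K0) = (t0 x == x)).
Hypotheses (K1E : forall x, (x \in K1) = (t1 x == x)).
Hypothesis index0 : subfield_index K0 predT 2.
Local Notation s := (spow t0 t1).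
Local Notation sigma := (t1 \o t0).

(** Tower law, through a basis of K0 over k and one of F over K0. *)
Lemma algebraic_span : algebraic_bimodule K0 K1 ->
  exists (k : divringClosed F) (q : nat) (b : 'I_q -> F),
  [/\ {subset k <= K0}, {subset k <= K1}
    & forall x, exists c : 'I_q -> F, (forall t, c t \in k) /\ x = \sum_t c t * b t].
Proof.
move=> [k [kK0 kK1 [n [b [_ bP]]] _ _]]; have [e [_ eP]] := index0.
exists k, #|{: 'I_n * 'I_2}|, (fun i => b (enum_val i).1 * e (enum_val i).2).
split=> // x; have [c [[cK ->] _]] := eP x isT.
have /choice [d dP] : forall r, exists d : 'I_n -> F,
    (forall t, d t \in k) /\ c r = \sum_t d t * b t.
  by move=> r; have [d [[dk dE] _]] := bP (c r) (cK r); exists d.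
exists (fun i => d (enum_val i).2 (enum_val i).1); split=> [t|].
  by have [dk _] := dP (enum_val t).2.
rewrite -(big_enum_val (fun p => d p.2 p.1 * (b p.1 * e p.2))) /=.
rewrite -(pair_bigA _ (fun t r => d r t * (b t * e r))) exchange_big /=.
apply: eq_bigr => r _; have [_ ->] := dP r; rewrite mulr_suml.
by apply: eq_bigr => t _; rewrite mulrA.
Qed.

Lemma iterE (n : nat) x : iter n sigma x = s n x. Proof. by []. Qed.

(** The powers of sigma are k-linear and F is spanned by q elements, so a (q+1) by q matrix has a
    left kernel vector, giving a relation among q + 1 powers of sigma. By Dedekind these cannot be
    distinct. *)
Lemma algebraic_finite_order : algebraic_bimodule K0 K1 -> finite_order sigma.
Proof.
move=> /algebraic_span [k [q [b [kK0 kK1 bP]]]].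
have sk n : {in k, forall c, s n c = c}.
  move=> c ck; have [/eqP c0 /eqP c1] : t0 c == c /\ t1 c == c.
    by rewrite -K0E -K1E; split; [apply: kK0 | apply: kK1].
  elim: n => [|n IH|n IH] //; first by rewrite intS spow1D // IH c0 c1.
  by rewrite intS opprD spowN1D // IH c1 c0.
apply: contrapT => inf.
have distinct (i j : nat) : (i < j < q.+1)%N -> exists x, s i x != s j x.
  move=> /andP[ij _]; apply: contrapT => /forallNP eq; apply: inf.
  exists (j - i)%N; first by rewrite subn_gt0.
  move=> x; have /negP := eq (s (- i%:Z) x); rewrite negbK -!spowD // subrr => /eqP e.
  by rewrite iterE -subzn 1?ltnW // -e.
pose M := \matrix_(i < q.+1, t < q) s i (b t).
have : kermx M != 0.
  rewrite kermx_eq0 /row_free neq_ltn ltnS; apply/orP; left.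
  exact: rank_leq_col.
move=> /rowV0Pn [v /sub_kermxP vM /eqP]; apply.
have vb t : \sum_(i < q.+1) v 0 i * s i (b t) = 0.
  have := congr1 (fun A : 'M_(1, q) => A 0 t) vM; rewrite !mxE => h.
  by rewrite -[RHS]h; apply: eq_bigr => i _; rewrite mxE.
apply/rowP => i; rewrite mxE.
have := @characters_independent F q.+1 (fun i => s i) (fun i => v 0 (inord i)).
move=> /(_ _ _ distinct) h; rewrite -[i]inord_val; apply: h (ltn_ord i).
- by move=> j; apply: rmorph1.
- by move=> j x y; apply: rmorphM.
move=> x; have [c [ck ->]] := bP x.
under eq_bigr => j _ do rewrite inord_val raddf_sum mulr_sumr.
rewrite exchange_big /= big1 // => t _.
under eq_bigr => j _ do rewrite rmorphM /= sk // mulrCA.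
by rewrite -mulr_sumr vb mulr0.
Qed.

Definition fixed_by : {pred F} := fun x => (t0 x == x) && (t1 x == x).

Lemma fixed_by_divring : divring_closed fixed_by.
Proof.
split=> [|x y|x y]; rewrite !unfold_in ?rmorph1 ?eqxx //.
  by move=> /andP[/eqP x0 /eqP x1] /andP[/eqP y0 /eqP y1]; rewrite !rmorphB x0 x1 y0 y1 !eqxx.
by move=> /andP[/eqP x0 /eqP x1] /andP[/eqP y0 /eqP y1]; rewrite !fmorph_div x0 x1 y0 y1 !eqxx.
Qed.
HB.instance Definition _ := GRing.isDivringClosed.Build F fixed_by fixed_by_divring.

Section Artin.
Variables (B : nat) (a : 'I_B -> F).

(** u annihilates every conjugate of the vector a under the group generated by t0 and t1, whose
    elements are the sigma^n and t0 sigma^n. Applying t0 or t1 to u permutes these conditions. *)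
Definition twisted_relation (u : 'I_B -> F) := forall n : int,
  \sum_t u t * s n (a t) = 0 /\ \sum_t u t * t0 (s n (a t)) = 0.

Lemma twisted_relationB u v : twisted_relation u -> twisted_relation v ->
  twisted_relation (fun t => u t - v t).
Proof.
move=> hu hv n; have [u0 u1] := hu n; have [v0 v1] := hv n.
by split; under eq_bigr do rewrite mulrBl; rewrite sumrB ?u0 ?u1 ?v0 ?v1 subrr.
Qed.

Lemma twisted_relationZ c u : twisted_relation u ->
  twisted_relation (fun t => c * u t).
Proof.
move=> hu n; have [u0 u1] := hu n.
by split; under eq_bigr do rewrite -mulrA; rewrite -mulr_sumr ?u0 ?u1 mulr0.
Qed.

Lemma twisted_relation_t0 u : twisted_relation u -> twisted_relation (fun t => t0 (u t)).
Proof.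
move=> hu n; have [u0 u1] := hu n; split.
  rewrite -[RHS](rmorph0 t0) -[in RHS]u1 rmorph_sum; apply: eq_bigr => t _.
  by rewrite rmorphM t0K.
rewrite -[RHS](rmorph0 t0) -[in RHS]u0 rmorph_sum; apply: eq_bigr => t _.
by rewrite rmorphM.
Qed.

Lemma twisted_relation_t1 u : twisted_relation u -> twisted_relation (fun t => t1 (u t)).
Proof.
move=> hu n; split.
  have [_ u1] := hu (-1 + n).
  rewrite -[RHS](rmorph0 t1) -[in RHS]u1 rmorph_sum; apply: eq_bigr => t _.
  by rewrite rmorphM spowN1D // t0K t1K.
have [u0 _] := hu (1 + n).
rewrite -[RHS](rmorph0 t1) -[in RHS]u0 rmorph_sum; apply: eq_bigr => t _.
by rewrite rmorphM spow1D // t1K.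
Qed.

(* Artin: a relation with minimal support and a coefficient 1 is fixed by t0 and
   t1, since otherwise its difference with its image would be shorter. *)
Lemma twisted_relation_fixed u : twisted_relation u -> (exists t, u t != 0) ->
  exists2 u' : 'I_B -> F, (forall t, u' t \in fixed_by) /\ (exists t, u' t != 0)
    & \sum_t u' t * a t = 0.
Proof.
have [m] := ubnP #|[set t | u t != 0]|.
elim: m u => // m IH u; rewrite ltnS => um hu [r ur].
pose v t := (u r)^-1 * u t; have hv := twisted_relationZ (u r)^-1 hu; rewrite -/v in hv.
have vr : v r = 1 by rewrite /v mulVf.
have shrink (f : {rmorphism F -> F}) t : twisted_relation (fun t => f (v t)) ->
    f (v t) != v t -> exists2 u' : 'I_B -> F,
    (forall t, u' t \in fixed_by) /\ (exists t, u' t != 0)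
    & \sum_t u' t * a t = 0.
  move=> hf ft; apply: (IH (fun t => f (v t) - v t)).
  - apply: leq_trans um; apply: proper_card; apply/properP; split.
      apply/subsetP => i; rewrite !inE; apply: contraNneq => ui.
      by rewrite /v ui mulr0 rmorph0 subrr.
    by exists r; rewrite !inE // vr rmorph1 subrr eqxx.
  - exact: twisted_relationB.
  - by exists t; rewrite subr_eq0.
have [t|f0] := pickP (fun t => t0 (v t) != v t).
  by apply: shrink; apply: twisted_relation_t0.
have [t|f1] := pickP (fun t => t1 (v t) != v t).
  by apply: shrink; apply: twisted_relation_t1.
exists v; last by have [] := hv 0.
split=> [t|]; last by exists r; rewrite vr oner_eq0.
by rewrite unfold_in; have := f0 t; have := f1 t; move=> /negbFE -> /negbFE ->.
Qed.

End Artin.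

(** When sigma^N = 1, the conditions of [twisted_relation] reduce to 2N linear equations, in 2N + 1
    unknowns; a nonzero solution is then made fixed by Artin's argument. *)
Lemma finite_order_dependent N (a : 'I_(N + N).+1 -> F) :
  (0 < N)%N -> s N =1 id ->
  exists2 u : 'I_(N + N).+1 -> F,
    (forall t, u t \in fixed_by) /\ (exists t, u t != 0) & \sum_t u t * a t = 0.
Proof.
move=> N0 sN.
have speriod (m : nat) x : s (m%:Z * N) x = x.
  by elim: m x => [|m IH] x; rewrite ?mul0r // intS mulrDl mul1r spowD // IH sN.
have sperZ (m : int) x : s (m * N) x = x.
  case: m => m //; rewrite NegzE mulNr.
  by rewrite -[in LHS](speriod m.+1 x) -spowD // addNr.
pose M := row_mx (\matrix_(j < (N + N).+1, n < N) s n (a j))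
                 (\matrix_(j < (N + N).+1, n < N) t0 (s n (a j))).
have : kermx M != 0.
  rewrite kermx_eq0 /row_free neq_ltn ltnS; apply/orP; left.
  exact: rank_leq_col.
move=> /rowV0Pn [v /sub_kermxP vM v0].
apply: (@twisted_relation_fixed _ a (fun t => v 0 t)); last first.
  by have /rV0Pn := v0.
move: vM; rewrite mul_mx_row => /eqP; rewrite row_mx_eq0 => /andP[/eqP e0 /eqP e1].
have small (n : 'I_N) : \sum_t v 0 t * s n (a t) = 0 /\ \sum_t v 0 t * t0 (s n (a t)) = 0.
  have := congr1 (fun A : 'M_(1, N) => A 0 n) e0.
  have := congr1 (fun A : 'M_(1, N) => A 0 n) e1.
  rewrite !mxE => h1 h0; split.
    by rewrite -[RHS]h0; apply: eq_bigr => i _; rewrite mxE.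
  by rewrite -[RHS]h1; apply: eq_bigr => i _; rewrite mxE.
move=> n; have [r rE] : exists r : 'I_N, forall x, s n x = s r x.
  have nn : (n %% N)%Z = `|(n %% N)%Z|%N.
    by rewrite gez0_abs // modz_ge0 // -lt0n.
  have lt : (`|(n %% N)%Z| < N)%N by rewrite -ltz_nat -nn ltz_pmod.
  exists (Ordinal lt) => x; rewrite /= -nn {1}(divz_eq n N) spowD //.
have [h0 h1] := small r; split.
  by under eq_bigr do rewrite rE.
by under eq_bigr do rewrite rE.
Qed.

Lemma finite_order_algebraic : finite_order sigma -> algebraic_bimodule K0 K1.
Proof.
move=> [N N0 sN].
exists (GRing.DivringClosed.clone F fixed_by _); split.
- by move=> x; rewrite unfold_in K0E => /andP[].
- by move=> x; rewrite unfold_in K1E => /andP[].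
- apply: (@exists_basis _ _ _ (N + N).+1) => a; exact: finite_order_dependent.
- apply: (@exists_basis _ _ _ (N + N).+1) => a; exact: finite_order_dependent.
- by move=> a x _; rewrite mulrC.
Qed.

End FiniteOrderAlgebraic.

(** * The ring Lambda_00 *)

Section MainAssembly.
Variables (F : fieldType) (K0 K1 : divringClosed F).
Variables (tau0 tau1 : {rmorphism F -> F}) (w : int -> F).
Hypothesis charF : 2%N \notin [pchar F].
Hypothesis index0 : subfield_index K0 predT 2.
Hypothesis index1 : subfield_index K1 predT 2.
Hypothesis gal0 : galois_involution K0 tau0.
Hypothesis gal1 : galois_involution K1 tau1.
Hypothesis adm_w : admissible_w K0 K1 w.
Local Notation Lambda := (localization (g_elt K0 K1 w)).

Definition tau (i : int) : {rmorphism F -> F} := if odd `|i|%N then tau1 else tau0.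

Lemma tauK i : involutive (tau i).
Proof. by rewrite /tau; case: odd; [apply: galoisK gal1 | apply: galoisK gal0]. Qed.

Lemma tau2 i : tau (i + 2) = tau i.
Proof. by rewrite /tau; have -> : odd (absz (i + 2)) = odd (absz i) by lia. Qed.

Lemma KmodE i x : (x \in Kmod2 K0 K1 i) = (tau i x == x).
Proof.
rewrite /Kmod2 /tau; case: odd; first exact: galois_fixedE index1 gal1 x.
exact: galois_fixedE index0 gal0 x.
Qed.

Lemma two_neq0 : 2%:R != 0 :> F.
Proof. by move: charF; rewrite inE. Qed.

Lemma tauw i : tau i (w i) = - w i.
Proof.
have [] := adm_w (i - 1); rewrite subrK !KmodE rmorphXn => wK w2 _.
by move: w2; rewrite eqf_sqr (negPf wK) => /eqP.
Qed.

Lemma w_neq0 i : w i != 0.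
Proof.
have [+ _ _] := adm_w (i - 1); rewrite subrK; apply: contraNneq => ->.
exact: rpred0.
Qed.

Lemma w_moved i : tau i (w (i + 1)) != w (i + 1).
Proof. by have [_ _] := adm_w i; rewrite KmodE. Qed.

Lemma Lambda_laurent : exists Y : int -> F -> zdiag Lambda 0,
  [/\ forall n, {morph Y n : a b / a - b},
      forall n a, Y (- n) a = Y n (tau0 a),
      forall (m : nat) n a b, Y m a * Y n b =
        Y (m%:Z + n) (a * spow tau0 tau1 m b)
        + Y (n - m%:Z) (tau0 a * spow tau0 tau1 (- m%:Z) b),
      Y 0 2^-1 = 1
    & forall P : zdiag Lambda 0 -> Prop, P 0 ->
        (forall x y, P x -> P y -> P (x - y)) ->
        (forall (n : nat) a, P (Y n a)) -> forall x, P x].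
Proof.
have Kfix i k : tau i k = k -> k \in Kmod2 K0 K1 i by rewrite KmodE => ->.
apply: (@zdiag_laurent F tau w two_neq0 tauK tau2 tauw w_neq0 w_moved Lambda
  (@scal _ K0 K1 w) (@gen_x _ K0 K1 w) (@gen_g _ K0 K1 w) (@gen_gi _ K0 K1 w)).
- by move=> i a b /Kfix aK /Kfix bK; apply: scalB.
- exact: scal1.
- by move=> i a b /Kfix aK /Kfix bK; apply: scalM.
- exact: gen_xB.
- by move=> i j k a /Kfix; apply: scal_gen_x.
- by move=> i j a k /Kfix; apply: gen_x_scal.
- exact: h_relation.
- by move=> i j; apply: g_relation; apply: w_neq0.
- exact: loc_map_g_gi.
- exact: gen_gi_loc_map.
move=> P P0 PB P1 Pio; apply: Lambda_ind => // i k x.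
by rewrite KmodE => /eqP; apply: Pio.
Qed.

Local Notation sigma := (tau1 \o tau0).

Lemma K0E x : (x \in K0) = (tau0 x == x). Proof. exact: (KmodE 0). Qed.
Lemma K1E x : (x \in K1) = (tau1 x == x). Proof. exact: (KmodE 1). Qed.

Lemma algebraic_iff_finite_order : algebraic_bimodule K0 K1 <-> finite_order sigma.
Proof.
by split; [apply: algebraic_finite_order (tauK 0) (tauK 1) K0E K1E index0
          | apply: finite_order_algebraic (tauK 0) (tauK 1) K0E K1E].
Qed.

Lemma Lambda_finite_over_center :
  algebraic_bimodule K0 K1 -> finite_over_center (zdiag Lambda 0).
Proof.
move=> alg; have [N N0 sN] := algebraic_iff_finite_order.1 alg.
have [k [q [b [kK0 kK1 bP]]]] := algebraic_span index0 alg.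
have [Y [YB YN YM Y_half Y_span]] := Lambda_laurent.
apply: (laurent_finite_over_center (tauK 0) (tauK 1) two_neq0 YB YN YM Y_span N0 sN _ _ bP).
  by move=> x /kK0; rewrite K0E => /eqP.
by move=> x /kK1; rewrite K1E => /eqP.
Qed.

(** If sigma^p fixed K0 pointwise, it would fix w_0^2 and send w_0 to w_0 or - w_0. Then sigma^2p
    would fix both K0 and w_0, hence all of F. *)
Lemma infinite_order_moves : ~ finite_order sigma ->
  forall p : nat, (0 < p)%N -> exists2 l, tau0 l = l & spow tau0 tau1 p l != l.
Proof.
move=> inf p p0; apply: contrapT => fixp.
have sfix l : tau0 l = l -> spow tau0 tau1 p l = l.
  by move=> lE; apply/eqP; apply: contrapT => /negP lP; apply: fixp; exists l.
have w2 : spow tau0 tau1 p (w 0) ^+ 2 = w 0 ^+ 2.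
  by rewrite -rmorphXn /= sfix // rmorphXn [tau0 _](tauw 0) sqrrN.
have spw : spow tau0 tau1 (p + p)%N (w 0) = w 0.
  rewrite PoszD (spowD (tauK 0) (tauK 1)).
  by move/eqP: w2; rewrite eqf_sqr => /orP[]/eqP e; rewrite e ?rmorphN /= e ?opprK.
apply: inf; exists (p + p)%N; first by rewrite addn_gt0 p0.
move=> y; rewrite -[LHS]/(spow tau0 tau1 (p + p)%N y).
have sfix2 l : tau0 l = l -> spow tau0 tau1 (p + p)%N l = l.
  by move=> lE; rewrite PoszD (spowD (tauK 0) (tauK 1)) !sfix.
have [a [b [aE bE -> _]]] := tau_decomp two_neq0 tauK tauw w_neq0 0 y.
by rewrite rmorphD rmorphM /= spw !sfix2.
Qed.

Lemma Lambda_simple : ~ algebraic_bimodule K0 K1 -> simple_ring (zdiag Lambda 0).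
Proof.
move=> nalg; have [Y [YB YN YM Y_half Y_span]] := Lambda_laurent.
apply: (laurent_simple (tauK 0) (tauK 1) two_neq0 YB YN YM Y_half Y_span).
  by apply: infinite_order_moves => fin; apply/nalg/algebraic_iff_finite_order.
apply: (Lambda_nontrivial two_neq0 tauK tau2 _ tauw w_neq0 w_moved).
by move=> i k; rewrite KmodE => /eqP.
Qed.

End MainAssembly.

Theorem theorem1p4 (F : fieldType) (K0 K1 : divringClosed F)
  (tau0 tau1 : {rmorphism F -> F}) (w : int -> F)
  (charF : 2%N \notin [pchar F])
  (index0 : subfield_index K0 predT 2)
  (index1 : subfield_index K1 predT 2)
  (simpleF : simple_bimodule K0 K1)
  (gal0 : galois_involution K0 tau0)
  (gal1 : galois_involution K1 tau1)
  (adm_w : admissible_w K0 K1 w) :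
  let sigma : F -> F := tau1 \o tau0 in
  let Lambda : zalg := localization (g_elt K0 K1 w) in
  ((algebraic_bimodule K0 K1 <-> finite_order sigma) /\
   (algebraic_bimodule K0 K1 -> finite_over_center (zdiag Lambda 0))) /\
  ((~ algebraic_bimodule K0 K1 <-> ~ finite_order sigma) /\
   (~ algebraic_bimodule K0 K1 -> simple_ring (zdiag Lambda 0))).
Proof.
move=> sigma Lambda.
have iff := algebraic_iff_finite_order index0 index1 gal0 gal1.
split; split=> //; first exact: Lambda_finite_over_center gal0 gal1 adm_w.
- by split=> h1 h2; apply: h1; apply/iff.
- exact: Lambda_simple gal0 gal1 adm_w.
Qed.
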